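(* $\alpha(3) < 0.313$.
   Context: Let $S^{2}=\{x\in\mathbb{R}^3:\langle x,x\rangle=1\}$ be the unit sphere in $\mathbb{R}^3$, where $\langle\cdot,\cdot\rangle$ is the standard inner product, and let $\lambda$ be the Lebesgue surface measure on $S^2$, normalised so that $\lambda(S^2)=1$. A subset $I\subset S^2$ is called $\{0\}$-avoiding if $\langle \xi,\eta\rangle\neq 0$ for all $\xi,\eta\in I$. Define $\alpha(3)$ to be the supremum of $\lambda(I)$ over all Lebesgue measurable $\{0\}$-avoiding sets $I\subset S^2$. *)

(* Defs.v *)
From HB Require Import structures.
From mathcomp Require Import all_boot all_order all_algebra.
From mathcomp Require Import all_classical all_reals all_analysis.
From mathcomp Require Import measurable_realfun ring.

Set Implicit Arguments.
Unset Strict Implicit.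
Unset Printing Implicit Defensive.
Import Order.TTheory GRing.Theory Num.Theory.
Import numFieldNormedType.Exports.

Local Open Scope classical_set_scope.
Local Open Scope ring_scope.

Definition inner (R : realType) (n : nat) (x y : 'rV[R]_n) : R :=
  \sum_(i < n) x 0 i * y 0 i.

Definition sphere2 (R : realType) : set 'rV[R]_3 := [set x | inner x x = 1].

Notation borel_rV3 R := (g_sigma_algebraType (@open 'rV[R]_3)).

(* [p.1] is the colatitude and [p.2] the longitude. *)
Definition spherical (R : realType) (p : R * R) : borel_rV3 R :=
  \row_(i < 3) nth 0 [:: sin p.1 * cos p.2; sin p.1 * sin p.2; cos p.1] i.

Definition spherical_dom (R : realType) : set (R * R) :=
  `[0, pi] `*` `[0, 2 * pi].

Section surface_measure.
Context {R : realType}.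
Local Notation leb := (@lebesgue_measure R).

Lemma measurable_spherical : measurable_fun setT (@spherical R).
Proof.
apply: measurability => //= _ [U oU <-]; rewrite setTI.
pose box (q : 'rV[rat]_3 * nat) : set 'rV[R]_3 :=
  [set y | forall i, `|ratr (q.1 0 i) - y 0 i| < q.2.+1%:R^-1].
have -> : U = \bigcup_(q in [set q | box q `<=` U]) box q.
  apply/seteqP; split => [x Ux|x [q /= qU]]; last exact: qU.
  have /nbhs_ballP[e /= e0 eU] : nbhs x U by exact: open_nbhs_nbhs.
  have e20 : 0 < e / 2 by rewrite divr_gt0.
  have [n _ /(_ n (leqnn n)) /= ne] := near_infty_natSinv_lt (PosNum e20).
  have rq i : exists q : rat, `|ratr q - x 0 i| < n.+1%:R^-1.
    have [|q] := @rat_in_itvoo R (x 0 i - n.+1%:R^-1) (x 0 i + n.+1%:R^-1).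
      by rewrite ltrBlDr -addrA ltrDl addr_gt0// invr_gt0.
    by rewrite in_itv /= => qx; exists q; rewrite ltr_distl.
  have [q qP] := choice rq.
  exists (\row_i q i, n) => [y /= yq|i] /=; last by rewrite mxE.
  apply: eU; split => // i j; rewrite (ord1 i).
  rewrite -ball_normE /=.
  have -> : x 0 j - y 0 j = (ratr (q j) - y 0 j) - (ratr (q j) - x 0 j).
    by rewrite opprB [RHS]addrC addrA subrK.
  rewrite (le_lt_trans (ler_normB _ _))// (splitr e) ltrD//.
    by have := yq j; rewrite mxE => /lt_trans; apply.
  by rewrite (lt_trans (qP j)).
rewrite preimage_bigcup bigcup_mkcond; apply: countable_bigcupT_measurable => [|q].
  exact: countableP.
case: ifP => // _.
have -> : @spherical R @^-1` box q = \bigcap_(i in [set: 'I_3])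
    ((fun p : R * R => `|ratr (q.1 0 i) - (spherical p : 'rV_3) 0 i|) @^-1`
       `]-oo, q.2.+1%:R^-1[).
  apply/seteqP; split => [p pq i _|p pq i]; first by rewrite /= in_itv/= pq.
  by have := pq i Logic.I; rewrite /= in_itv.
apply: fin_bigcap_measurable => [|i _]; first exact: finite_finset.
rewrite -[X in measurable X]setTI.
have mi : measurable_fun setT (fun p : R * R => (spherical p : 'rV_3) 0 i).
  have [ms1 mc1] : measurable_fun setT (fun p : R * R => sin p.1) /\
                   measurable_fun setT (fun p : R * R => cos p.1).
    by split; apply: measurableT_comp => //; apply: continuous_measurable_fun;
      [exact: continuous_sin|exact: continuous_cos].
  have [ms2 mc2] : measurable_fun setT (fun p : R * R => sin p.2) /\
                   measurable_fun setT (fun p : R * R => cos p.2).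
    by split; apply: measurableT_comp => //; apply: continuous_measurable_fun;
      [exact: continuous_sin|exact: continuous_cos].
  under eq_fun do rewrite mxE.
  by case: i => -[|[|[|//]]] ? /=; [exact: measurable_funM..|].
suff : measurable_fun setT
    (fun p : R * R => `|ratr (q.1 0 i) - (spherical p : 'rV_3) 0 i|).
  by apply.
by apply: measurableT_comp => //; exact: measurable_funB.
Qed.

Lemma measurable_spherical_dom : measurable (@spherical_dom R).
Proof. exact: measurableX. Qed.

(* The density is the area element [sin p.1] of the spherical coordinates,
   divided by the total area [4 * pi]. *)
Definition sphere_measure (A : set (borel_rV3 R)) : \bar R :=
  (\int[leb \x leb]_(p in @spherical_dom R `&` @spherical R @^-1` A)
     (sin p.1 / (4 * pi))%:E)%E.

Let density_ge0 (p : R * R) : spherical_dom p -> (0 <= (sin p.1 / (4 * pi))%:E)%E.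
Proof.
case=> /= + _; rewrite in_itv /= => p1.
by rewrite lee_fin divr_ge0 ?mulr_ge0 ?pi_ge0// sin_ge0_pi.
Qed.

Let measurable_density :
  measurable_fun setT (fun p : R * R => (sin p.1 / (4 * pi))%:E).
Proof.
apply/measurable_EFinP; apply: measurable_funM => //.
by apply: measurableT_comp => //; apply: continuous_measurable_fun; exact: continuous_sin.
Qed.

Let mpre A : measurable A -> measurable (@spherical_dom R `&` @spherical R @^-1` A).
Proof.
move=> mA; apply: measurableI; first exact: measurable_spherical_dom.
by rewrite -[X in measurable X]setTI; exact: measurable_spherical.
Qed.

Let sphere_measure0 : sphere_measure set0 = 0%E.
Proof. by rewrite /sphere_measure preimage_set0 setI0 integral_set0. Qed.

Let sphere_measure_ge0 A : (0 <= sphere_measure A)%E.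
Proof. by apply: integral_ge0 => p [+ _]; exact: density_ge0. Qed.

Let sphere_measure_sigma_additive : semi_sigma_additive sphere_measure.
Proof.
move=> F mF tF mUF; rewrite /sphere_measure preimage_bigcup setI_bigcupr.
rewrite ge0_integral_bigcup//=.
- apply: is_cvg_ereal_nneg_natsum_cond => n _ _.
  exact: sphere_measure_ge0.
- by move=> k; exact: mpre.
- exact: measurable_funTS.
- by move=> p [k _ [+ _]]; exact: density_ge0.
- apply/trivIsetP => i j _ _ ij; rewrite setIACA setIid -preimage_setI.
  by move/trivIsetP : tF => -> //; rewrite preimage_set0 setI0.
Qed.

HB.instance Definition _ := isMeasure.Build _ _ _ sphere_measure
  sphere_measure0 sphere_measure_ge0 sphere_measure_sigma_additive.

Lemma sphere_measure_sphere2 : sphere_measure (@sphere2 R) = 1%E.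
Proof.
rewrite /sphere_measure.
have -> : @spherical_dom R `&` @spherical R @^-1` @sphere2 R = @spherical_dom R.
  apply/setIidPl => p _; rewrite /sphere2 /= /inner !big_ord_recl big_ord0 !mxE /=.
  rewrite addr0 -!expr2 !exprMn addrA -mulrDr cos2Dsin2 mulr1 addrC.
  by rewrite cos2Dsin2.
rewrite integral_mkcond.
have mf : measurable_fun setT
    ((fun p : R * R => (sin p.1 / (4 * pi))%:E) \_ (@spherical_dom R)).
  by apply/(measurable_restrictT _ measurable_spherical_dom); exact: measurable_funTS.
have f0 p : (0 <= ((fun p : R * R => (sin p.1 / (4 * pi))%:E) \_ (@spherical_dom R)) p)%E.
  by rewrite patchE; case: ifPn => // /set_mem; exact: density_ge0.
rewrite (@fubini_tonelli1 _ _ _ _ _ leb leb _ mf f0) /fubini_F /=.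
transitivity (\int[leb]_(x in `[0%R, pi]) (sin x / 2)%:E)%E.
  rewrite [RHS]integral_mkcond; apply: eq_integral => x _.
  rewrite patchE; case: ifPn => [/set_mem x0|/negP x0].
    transitivity (\int[leb]_(y in `[0%R, (2 * pi)%R]) (sin x / (4 * pi))%:E)%E.
      rewrite [RHS]integral_mkcond; apply: eq_integral => y _.
      rewrite !patchE; congr (if _ then _ else _).
      by apply/idP/idP => /set_mem; [case=> _ /= ?; exact: mem_set|
        move=> ?; apply: mem_set; split].
    rewrite integral_cst//= lebesgue_measure_itv /= lte_fin.
    rewrite mulr_gt0 ?pi_gt0// -EFinB subr0 -EFinM.
    have : (pi : R) != 0 by rewrite gt_eqF// pi_gt0.
    by move: (pi : R) (sin x : R) => p s p0; congr (_%:E); field.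
  apply: integral0_eq => y _; rewrite patchE; case: ifPn => // /set_mem[/= x1 _].
  by case: x0; exact: mem_set.
have dF (x : R) : is_derive x 1 (fun x : R => - cos x / 2) (sin x / 2).
  apply: is_derive_eq.
  by rewrite !scaler0 add0r opprK [RHS]mulrC.
rewrite (@continuous_FTC2 _ _ (fun x => - cos x / 2)) ?pi_gt0//.
- rewrite cospi cos0 -EFinB; congr (_%:E); by field.
- apply: continuous_subspaceT => x.
  by apply: cvgM; [exact: continuous_sin|exact: cvg_cst].
- split.
  + by move=> x _; exact: ex_derive.
  + apply: cvg_at_right_filter; apply: cvgM; last exact: cvg_cst.
    by apply: cvgN; exact: continuous_cos.
  + apply: cvg_at_left_filter; apply: cvgM; last exact: cvg_cst.
    by apply: cvgN; exact: continuous_cos.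
- by move=> x _; rewrite derive1E derive_val.
Qed.

End surface_measure.

(* The Lebesgue measurable sets are those of the completion of the Borel
   sigma-algebra, which the library builds by the Caratheodory criterion. *)
Definition lebesgue_measurable_sphere (R : realType) (I : set 'rV[R]_3) : Prop :=
  I `<=` @sphere2 R /\ ((@sphere_measure R)^*)%mu.-cara.-measurable I.

Definition lambda (R : realType) : set 'rV[R]_3 -> \bar R :=
  @completed_measure_extension _ _ _ (@sphere_measure R).

Definition zero_avoiding (R : realType) (I : set 'rV[R]_3) : Prop :=
  forall xi eta, I xi -> I eta -> inner xi eta <> 0.

Definition alpha3 (R : realType) : \bar R :=
  ereal_sup [set lambda I | I in
    [set I : set 'rV[R]_3 | lebesgue_measurable_sphere I /\ zero_avoiding I]].

(* Main.v *)
Require Import Defs.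
From HB Require Import structures.
From mathcomp Require Import all_boot all_order all_algebra.
From mathcomp Require Import all_classical all_reals all_analysis.
From mathcomp Require Import measurable_realfun ring lra.

(* The orthogonality graph on the 37 lines spanned by integer vectors of squared
   norm 1, 2, 3, 5, 6 with entries at most 2 carries a weight of total 104 for
   which no independent set weighs more than 32. Moving this configuration by a
   random rotation whose action on any fixed unit vector is uniform on the
   sphere, a Borel set A without orthogonal pairs always meets it in an
   independent set, so 104 lambda(A) <= 32, that is lambda(A) <= 4/13 < 0.313.

   The random rotation is x |-> q x q^-1 with q uniform in the unit ball of the
   quaternions. Right multiplication of q by a unit quaternion is a product of
   shears and preserves Lebesgue measure, so all unit vectors have images with
   the same law. For the third basis vector this is the law of the Hopf map: it
   is invariant under rotations about the vertical axis and its height is uniform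
   on [-1, 1], and these two properties characterize the surface measure. *)

Set Implicit Arguments.
Unset Strict Implicit.
Unset Printing Implicit Defensive.
Import Order.TTheory GRing.Theory Num.Theory.
Import numFieldNormedType.Exports.

Local Open Scope classical_set_scope.
Local Open Scope ring_scope.

(** * Measure-preserving maps *)

Section preserving.
Context {R : realType}.

Definition preserves d (T : measurableType d) (mu : set T -> \bar R)
    (f : T -> T) :=
  measurable_fun setT f /\ forall A, measurable A -> mu (f @^-1` A) = mu A.

Lemma measurable_preimage d d' (T : measurableType d) (T' : measurableType d')
    (f : T -> T') A : measurable_fun setT f -> measurable A ->
  measurable (f @^-1` A).
Proof. by move=> mf mA; rewrite -[X in measurable X]setTI; exact: mf. Qed.

Lemma preserves_comp d (T : measurableType d) (mu : set T -> \bar R)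
    (f g : T -> T) : preserves mu f -> preserves mu g -> preserves mu (f \o g).
Proof.
move=> [mf pf] [mg pg]; split=> [|A mA]; first exact: measurableT_comp.
by rewrite comp_preimage pg ?pf//; exact: measurable_preimage.
Qed.

(** Cavalieri's principle: the section at [x] of the preimage is the preimage under [s x] of the
    section, and [m1 \x m2] integrates the measures of these sections. *)
Lemma preserves_shear_snd d1 d2 (T1 : measurableType d1) (T2 : measurableType d2)
    (m1 : {sigma_finite_measure set T1 -> \bar R})
    (m2 : {sigma_finite_measure set T2 -> \bar R}) (s : T1 -> T2 -> T2) :
  measurable_fun setT (fun p : T1 * T2 => s p.1 p.2) ->
  (forall x, preserves m2 (s x)) ->
  preserves (m1 \x m2)%E (fun p => (p.1, s p.1 p.2)).
Proof.
move=> ms ps; split=> [|A mA]; first exact: measurable_fun_pair.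
apply: eq_integral => x _ /=.
have -> : xsection ((fun p => (p.1, s p.1 p.2)) @^-1` A) x = s x @^-1` xsection A x.
  by apply/seteqP; split => y /=; rewrite /xsection /= !inE.
by apply: (ps x).2; exact: measurable_xsection.
Qed.

(** Tonelli. Slicing along the second factor serves for shears of the first coordinate and, later,
    for the slices of [ball4]. *)
Lemma product_measureE2 d1 d2 (T1 : measurableType d1) (T2 : measurableType d2)
    (m1 : {sigma_finite_measure set T1 -> \bar R})
    (m2 : {sigma_finite_measure set T2 -> \bar R}) A : measurable A ->
  ((m1 \x m2) A = \int[m2]_y m1 (ysection A y))%E.
Proof.
move=> mA; have := indic_fubini_tonelli m1 m2 mA.
rewrite (indic_fubini_tonelli_FE m2 mA) => h; apply: (eq_trans h).
by apply: eq_integral => y _; rewrite (indic_fubini_tonelli_GE m1 mA).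
Qed.

Lemma preserves_shear_fst d1 d2 (T1 : measurableType d1) (T2 : measurableType d2)
    (m1 : {sigma_finite_measure set T1 -> \bar R})
    (m2 : {sigma_finite_measure set T2 -> \bar R}) (s : T2 -> T1 -> T1) :
  measurable_fun setT (fun p : T1 * T2 => s p.2 p.1) ->
  (forall y, preserves m1 (s y)) ->
  preserves (m1 \x m2)%E (fun p => (s p.2 p.1, p.2)).
Proof.
move=> ms ps.
have mf : measurable_fun setT (fun p : T1 * T2 => (s p.2 p.1, p.2)).
  exact: measurable_fun_pair.
split=> // A mA.
rewrite !product_measureE2//; last exact: measurable_preimage.
apply: eq_integral => y _ /=.
have -> : ysection ((fun p => (s p.2 p.1, p.2)) @^-1` A) y = s y @^-1` ysection A y.
  by apply/seteqP; split => x /=; rewrite /ysection /= !inE.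
by apply: (ps y).2; exact: measurable_ysection.
Qed.

Local Notation leb := (@lebesgue_measure R).

(** [k] times the image of Lebesgue measure under the affine map agrees with Lebesgue measure on
    half-open intervals, hence everywhere by uniqueness. *)
Lemma lebesgue_measure_affine (k c : R) (A : set (measurableTypeR R)) : 0 < k ->
  measurable A -> leb ((fun x => k * x + c) @^-1` A) = (k^-1%:E * leb A)%E.
Proof.
move=> k0 mA.
have mf0 : measurable_fun setT (fun x : measurableTypeR R => k * x + c).
  by apply: measurable_funD => //; exact: measurable_funM.
have mf : @measurable_fun _ _ (measurableTypeR R) (measurableTypeR R) setT
  (fun x => k * x + c) by exact: mf0.
have k0' : 0 <= k by exact: ltW.
pose f : measurableTypeR R -> measurableTypeR R := fun x => k * x + c.
pose mu : {measure set (measurableTypeR R) -> \bar R} :=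
  mscale (NngNum k0') (pushforward leb f).
have -> : leb A = mu mf A; last first.
  by rewrite /mu /= /mscale /pushforward /= muleA -EFinM mulVf ?gt_eqF// mul1e.
apply: lebesgue_measure_unique => //=.
move=> _ [[a b] /= ab <-].
have E : f @^-1` `]a, b]%classic =
    `](a - c) / k, (b - c) / k]%classic.
  apply/seteqP; split => x /=; rewrite /f !in_itv /= => /andP[h1 h2];
    apply/andP; split.
  - by rewrite ltr_pdivrMr// mulrC ltrBlDr.
  - by rewrite ler_pdivlMr// mulrC lerBrDr.
  - by move: h1; rewrite ltr_pdivrMr// mulrC ltrBlDr.
  - by move: h2; rewrite ler_pdivlMr// mulrC lerBrDr.
rewrite /mu /mscale /= /pushforward E !lebesgue_measure_itv /= !lte_fin.
rewrite ltr_pM2r ?invr_gt0// ltrD2r.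
case: ifPn => _; last by rewrite mule0.
rewrite -!EFinB -EFinM; congr (_%:E); field; by rewrite gt_eqF.
Qed.

Lemma preserves_translation (c : R) : preserves leb (fun x : measurableTypeR R => x + c).
Proof.
split=> [|A mA]; first exact: measurable_funD.
have := @lebesgue_measure_affine 1 c A ltr01 mA.
rewrite invr1 mul1e => <-; congr (leb _).
by apply/seteqP; split => x /=; rewrite mul1r.
Qed.

(* The product measure is wrapped because the library does not infer that
   [leb \x leb] is sigma-finite. *)
Definition leb2 := (leb \x leb)%E.
HB.instance Definition _ := Measure.on leb2.

Let leb2_sigma_finite : sigma_finite setT leb2.
Proof.
pose I (n : nat) : set (measurableTypeR R) := `[- n%:R, n%:R]%classic.
exists (fun n => I n `*` I n) => [|n].
  apply/esym; rewrite -subTset => -[x y] _; exists (Num.bound (`|x| + `|y|)) => //.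
  have := archi_boundP (addr_ge0 (normr_ge0 x) (normr_ge0 y)).
  rewrite /I /= !in_itv /= -!ler_norml => xy.
  by split; apply: le_trans (ltW xy); [rewrite lerDl|rewrite lerDr].
have mI : measurable (I n) by exact: measurable_itv.
split; first exact: measurableX.
rewrite /leb2 product_measure1E//= lebesgue_measure_itv /=.
by case: ifP => _; rewrite -?EFinB -EFinM ltry.
Qed.

HB.instance Definition _ := Measure_isSigmaFinite.Build _ _ _ leb2 leb2_sigma_finite.

Definition leb4 := (leb2 \x leb2)%E.
HB.instance Definition _ := Measure.on leb4.

Lemma preserves_translation2 (c d : R) :
  preserves leb2 (fun z => (z.1 + c, z.2 + d)).
Proof.
have U : preserves leb2 (fun z => (z.1 + c, z.2)).
  apply: (@preserves_shear_fst _ _ _ _ leb leb (fun _ x => x + c)) => [|_].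
    exact: measurable_funD.
  exact: preserves_translation.
have L : preserves leb2 (fun z => (z.1, z.2 + d)).
  apply: (@preserves_shear_snd _ _ _ _ leb leb (fun _ x => x + d)) => [|_].
    exact: measurable_funD.
  exact: preserves_translation.
exact: preserves_comp U L.
Qed.

(** A rotation other than the half-turn is a product of three shears, and a shear translates each
    line of a parallel family along itself. *)
Lemma preserves_rotation (p s : R) : p != -1 -> p ^+ 2 + s ^+ 2 = 1 ->
  preserves leb2 (fun z => (p * z.1 - s * z.2, s * z.1 + p * z.2)).
Proof.
move=> p1 ps; have p1' : 1 + p != 0.
  by apply: contra p1; rewrite addrC addr_eq0.
(* Minus the tangent of half the angle, which is infinite only at the excluded value [p = -1]. *)
pose x := - s / (1 + p).
have mlin k (T : measurableType _) (f g : T -> R) :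
    measurable_fun setT f -> measurable_fun setT g ->
    measurable_fun setT (fun z => f z + k * g z).
  by move=> mf mg; apply: measurable_funD => //; exact: measurable_funM.
have U : preserves leb2 (fun z => (z.1 + x * z.2, z.2)).
  apply: (@preserves_shear_fst _ _ _ _ leb leb (fun z2 z1 => z1 + x * z2)) => [|y].
    exact: mlin.
  exact: preserves_translation.
have L : preserves leb2 (fun z => (z.1, z.2 + s * z.1)).
  apply: (@preserves_shear_snd _ _ _ _ leb leb (fun z1 z2 => z2 + s * z1)) => [|y].
    exact: mlin.
  exact: preserves_translation.
have := preserves_comp U (preserves_comp L U).
congr (preserves _ _); apply/funext => -[a b] /=.
have N0 : 1 + x ^+ 2 != 0 by rewrite gt_eqF// ltr_wpDr ?sqr_ge0.
have s2 : s ^+ 2 = 1 - p ^+ 2 by rewrite -ps addrC addKr.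
have Np : (1 + x ^+ 2) * (1 + p) = 2.
  apply: (mulIf p1'); rewrite mulrDl mul1r mulrDl -mulrA -expr2.
  have -> : x ^+ 2 * (1 + p) ^+ 2 = s ^+ 2 by rewrite /x; field.
  by rewrite s2; ring.
(* The half-angle formulas make [p] and [s] rational in [x], so that the matrix identity becomes one
   between fractions in [x]. *)
have pE : p = 2 / (1 + x ^+ 2) - 1 by apply/(mulfI N0); rewrite -{1}Np; field.
have sE : s = - x * (1 + p) by rewrite /x; field.
by congr pair; rewrite sE pE; field.
Qed.

(* A matrix of determinant 1 over the complex numbers is a product of three
   shears; this one is right multiplication by the quaternion p + v i + w j. *)
Lemma preserves_rotation4 (p v w : R) : p != -1 -> p ^+ 2 + v ^+ 2 + w ^+ 2 = 1 ->
  preserves leb4 (fun q =>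
    ((p * q.1.1 - v * q.2.1 - w * q.2.2, p * q.1.2 + w * q.2.1 - v * q.2.2),
     (p * q.2.1 + v * q.1.1 - w * q.1.2, p * q.2.2 + v * q.1.2 + w * q.1.1))).
Proof.
move=> p1 ps; have p1' : 1 + p != 0.
  by apply: contra p1; rewrite addrC addr_eq0.
have mlin k l d (T : measurableType d) (f g h : T -> R) :
    measurable_fun setT f -> measurable_fun setT g -> measurable_fun setT h ->
    measurable_fun setT (fun z => f z + (k * g z + l * h z)).
  by move=> mf mg mh; apply: measurable_funD => //; apply: measurable_funD;
    exact: measurable_funM.
have shear x y : preserves leb4 (fun q =>
    ((q.1.1 + (x * q.2.1 + - y * q.2.2), q.1.2 + (y * q.2.1 + x * q.2.2)), q.2)).
  apply: (@preserves_shear_fst _ _ _ _ leb2 leb2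
    (fun z2 z1 => (z1.1 + (x * z2.1 + - y * z2.2), z1.2 + (y * z2.1 + x * z2.2)))).
    by apply: measurable_fun_pair; apply: mlin => //; exact: measurableT_comp.
  by move=> z; exact: preserves_translation2.
have shear' x y : preserves leb4 (fun q =>
    (q.1, (q.2.1 + (x * q.1.1 + - y * q.1.2), q.2.2 + (y * q.1.1 + x * q.1.2)))).
  apply: (@preserves_shear_snd _ _ _ _ leb2 leb2
    (fun z1 z2 => (z2.1 + (x * z1.1 + - y * z1.2), z2.2 + (y * z1.1 + x * z1.2)))).
    by apply: measurable_fun_pair; apply: mlin => //; exact: measurableT_comp.
  by move=> z; exact: preserves_translation2.
(* With [t = v + i w] and complex coordinates [z1], [z2], the map is
   [(p z1 - conj t z2, p z2 + t z1)]. The outer shears have slope [x + i y = - conj t / (1 + p)],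
   the middle one slope [t]. *)
pose x := - v / (1 + p); pose y := w / (1 + p).
have := preserves_comp (shear x y) (preserves_comp (shear' v w) (shear x y)).
congr (preserves _ _); apply/funext => -[[a d] [b c]] /=.
have N0 : 1 + x ^+ 2 + y ^+ 2 != 0.
  by rewrite gt_eqF// -addrA ltr_wpDr ?addr_ge0 ?sqr_ge0.
have Np : (1 + x ^+ 2 + y ^+ 2) * (1 + p) = 2.
  apply: (mulIf p1'); have -> : (1 + x ^+ 2 + y ^+ 2) * (1 + p) * (1 + p) =
    (1 + p) ^+ 2 + (p ^+ 2 + v ^+ 2 + w ^+ 2) - p ^+ 2 by rewrite /x /y; field.
  by rewrite ps; ring.
have pE : p = 2 / (1 + x ^+ 2 + y ^+ 2) - 1.
  by apply/(mulfI N0); rewrite -{1}Np; field.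
have vE : v = - x * (1 + p) by rewrite /x; field.
have wE : w = y * (1 + p) by rewrite /y; field.
by congr (pair (pair _ _) (pair _ _)); rewrite vE wE pE; field.
Qed.

End preserving.

(** * Borel maps into the space of rows *)

Section sphere_coordinates.
Context {R : realType}.
Local Notation leb := (@lebesgue_measure R).

Definition row3 (a b c : R) : borel_rV3 R :=
  \row_(i < 3) nth 0 [:: a; b; c] i.

(* Locked so that simplification does not turn projections of [coords x] into
   matrix entries. *)
Definition coords : borel_rV3 R -> R * R * R :=
  locked (fun x : 'rV[R]_3 => (x 0 0, x 0 1, x 0 2%:R)).

Lemma coordsK x : row3 (coords x).1.1 (coords x).1.2 (coords x).2 = x.
Proof.
apply/rowP => i; rewrite mxE /coords -lock.
by case: i => -[|[|[|//]]] ? /=; congr (_ _ _); exact: val_inj.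
Qed.

Lemma row3K a b c : coords (row3 a b c) = (a, b, c).
Proof. by rewrite /coords -lock !mxE. Qed.

Lemma inner_row3 (a b c a' b' c' : R) :
  inner (row3 a b c) (row3 a' b' c') = a * a' + b * b' + c * c'.
Proof. by rewrite /inner !big_ord_recl big_ord0 !mxE /= addr0 addrA. Qed.

(** The target carries the sigma-algebra generated by the open sets, and every open set is a
    countable union of boxes with rational centres. *)
Lemma measurable_row3 d (T : measurableType d) (f g h : T -> R) :
  measurable_fun setT f -> measurable_fun setT g -> measurable_fun setT h ->
  measurable_fun setT (fun t => row3 (f t) (g t) (h t)).
Proof.
move=> mf mg mh; apply: measurability => //= _ [U oU <-]; rewrite setTI.
pose box (q : rat * rat * rat * nat) : set (R * R * R) := [set y |
  [/\ `|y.1.1 - ratr q.1.1.1| < q.2.+1%:R^-1, `|y.1.2 - ratr q.1.1.2| < q.2.+1%:R^-1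
    & `|y.2 - ratr q.1.2| < q.2.+1%:R^-1]].
pose r3 (y : R * R * R) := row3 y.1.1 y.1.2 y.2.
have UE : r3 @^-1` U = \bigcup_(q in [set q | box q `<=` r3 @^-1` U]) box q.
  apply/seteqP; split=> [[[a b] c] Uy|y [q /= + qy]]; last exact.
  have /nbhs_ballP[e /= e0 eU] : nbhs (row3 a b c : 'rV_3) U by exact: open_nbhs_nbhs.
  have e20 : 0 < e / 2 by rewrite divr_gt0.
  have [n _ /(_ n (leqnn n)) /= ne] := near_infty_natSinv_lt (PosNum e20).
  have approx (x : R) : exists q : rat, `|x - ratr q| < n.+1%:R^-1.
    have [|q] := @rat_in_itvoo R (x - n.+1%:R^-1) (x + n.+1%:R^-1).
      by rewrite ltrBlDr -addrA ltrDl addr_gt0// invr_gt0.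
    by rewrite in_itv /= => qx; exists q; rewrite distrC ltr_distl.
  have [[qa aP] [[qb bP] [qc cP]]] := (approx a, (approx b, approx c)).
  have close (x y : R) q : `|x - ratr q| < n.+1%:R^-1 -> `|y - ratr q| < n.+1%:R^-1 ->
      `|x - y| < e.
    move=> xq yq; rewrite (le_lt_trans (ler_distD (ratr q) _ _))// [e]splitr.
    by apply: ltrD; [exact: lt_trans ne|rewrite distrC; exact: lt_trans ne].
  exists (qa, qb, qc, n) => //= -[[a' b'] c'] [/= aP' bP' cP'].
  apply: eU; split=> // i j; rewrite -ball_normE /= !mxE.
  by case: j => -[|[|[|//]]] ? /=; [exact: close aP aP'|exact: close bP bP'|exact: close cP cP'].
have -> : (fun t => row3 (f t) (g t) (h t)) @^-1` U =
    (fun t => (f t, g t, h t)) @^-1` (r3 @^-1` U) by [].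
rewrite UE preimage_bigcup bigcup_mkcond.
apply: countable_bigcupT_measurable => [|q]; first exact: countableP.
case: ifP => // _.
have mabs (k : T -> R) r e : measurable_fun setT k ->
    measurable [set t | `|k t - r| < e].
  move=> mk; have mk' : measurable_fun setT (fun t => `|k t - r|).
    by apply: measurableT_comp => //; exact: measurable_funB.
  rewrite (_ : [set t | _] = (fun t => `|k t - r|) @^-1` `]-oo, e[).
    exact: measurable_preimage.
  by apply/seteqP; split => t /=; rewrite in_itv.
rewrite (_ : _ @^-1` _ = [set t | `|f t - ratr q.1.1.1| < q.2.+1%:R^-1] `&`
  [set t | `|g t - ratr q.1.1.2| < q.2.+1%:R^-1] `&`
  [set t | `|h t - ratr q.1.2| < q.2.+1%:R^-1]).
  by apply: measurableI; [apply: measurableI|]; exact: mabs.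
by apply/seteqP; split => t /= => [[]|[[]]].
Qed.

Lemma measurable_coord1 (i : 'I_3) :
  measurable_fun setT (fun x : borel_rV3 R => (x : 'rV[R]_3) 0 i).
Proof.
apply: (measurability _ (RGenOpens.measurableE R)) => _ [_ [a [b ->]] <-].
rewrite setTI; apply: sub_sigma_algebra.
by apply: open_comp => [x _|]; [exact: coord_continuous|exact: interval_open].
Qed.

Lemma measurable_coords : measurable_fun setT coords.
Proof.
rewrite (_ : coords = fun x : borel_rV3 R => ((x : 'rV_3) 0 0, (x : 'rV_3) 0 1,
  (x : 'rV_3) 0 2%:R)); last by rewrite /coords -lock.
have := measurable_fun_pair (measurable_fun_pair (measurable_coord1 0)
  (measurable_coord1 1)) (measurable_coord1 2%:R).
apply.
Qed.

End sphere_coordinates.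

(** * Measures invariant under rotations about the vertical axis *)

Section rotation_invariance.
Context {R : realType}.
Local Notation leb := (@lebesgue_measure R).

Definition rotz (t : R) (x : borel_rV3 R) : borel_rV3 R :=
  let y := coords x in
  row3 (cos t * y.1.1 - sin t * y.1.2) (sin t * y.1.1 + cos t * y.1.2) y.2.

(** Height and longitude as coordinates. For [z ^+ 2 > 1] the square root is 0 and the point lies on
    the vertical axis, off the sphere. *)
Definition cyl (z t : R) : borel_rV3 R :=
  row3 (Num.sqrt (1 - z ^+ 2) * cos t) (Num.sqrt (1 - z ^+ 2) * sin t) z.

Lemma rotz_cyl t z u : rotz t (cyl z u) = cyl z (u + t).
Proof. by rewrite /rotz /cyl row3K /= cosD sinD; congr row3; ring. Qed.

Lemma cylD2pi z t : cyl z (t + 2 * pi) = cyl z t.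
Proof. by rewrite /cyl mulr_natl sinD2pi cosD2pi. Qed.

Lemma inner_coords (x : 'rV[R]_3) : inner x x =
  (coords x).1.1 ^+ 2 + (coords x).1.2 ^+ 2 + (coords x).2 ^+ 2.
Proof. by rewrite -{1 2}(coordsK x) inner_row3 -!expr2. Qed.

(** The longitude is an arc cosine, reflected to [2 * pi - acos] when the second coordinate is
    negative; at the poles 0 is taken. *)
Lemma cyl_sphere2 (x : 'rV[R]_3) : sphere2 x ->
  exists2 t, 0 <= t <= 2 * pi & cyl (coords x).2 t = x.
Proof.
rewrite /sphere2 /mkset inner_coords.
move: (coordsK x); case: (coords x) => [[a b] c] /= <- abc.
have [r0|r0] := eqVneq (a ^+ 2 + b ^+ 2) 0.
  exists 0; first by rewrite lexx mulr_ge0 ?pi_ge0.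
  have : c ^+ 2 = 1 by rewrite -abc r0 add0r.
  rewrite /cyl /= => ->; rewrite subrr sqrtr0 !mul0r; move/eqP : r0.
  by rewrite paddr_eq0 ?sqr_ge0// !sqrf_eq0 => /andP[/eqP -> /eqP ->].
have {r0} : 0 < a ^+ 2 + b ^+ 2 by rewrite lt0r r0 addr_ge0 ?sqr_ge0.
have -> : a ^+ 2 + b ^+ 2 = 1 - c ^+ 2 by rewrite -abc addrK.
set r := Num.sqrt (1 - c ^+ 2) => r20.
have r0 : 0 < r by rewrite sqrtr_gt0.
have rr : r ^+ 2 = a ^+ 2 + b ^+ 2 by rewrite sqr_sqrtr ?ltW// -abc addrK.
have ar : -1 <= a / r <= 1.
  rewrite -ler_norml normrM normfV (gtr0_norm r0) ler_pdivrMr// mul1r.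
  by rewrite -sqrtr_sqr ler_wsqrtr// -abc addrK lerDl sqr_ge0.
have cosE : r * cos (acos (a / r)) = a.
  by rewrite acosK ?in_itv//= mulrC divfK// gt_eqF.
have sinE : r * sin (acos (a / r)) = `|b|.
  rewrite sin_acos//.
  have -> : r * Num.sqrt (1 - (a / r) ^+ 2) = Num.sqrt (r ^+ 2 * (1 - (a / r) ^+ 2)).
    by rewrite sqrtrM ?sqr_ge0// sqrtr_sqr gtr0_norm.
  have -> : r ^+ 2 * (1 - (a / r) ^+ 2) = r ^+ 2 - a ^+ 2 by field; rewrite gt_eqF.
  by rewrite rr [_ + b ^+ 2]addrC addrK sqrtr_sqr.
have [b0|b0] := leP 0 b.
  exists (acos (a / r)); last by rewrite /cyl -/r cosE sinE ger0_norm.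
  rewrite acos_ge0//= (le_trans (acos_lepi ar))// -[leLHS]mul1r ler_wpM2r ?pi_ge0//.
  by rewrite ler1n.
exists (2 * pi - acos (a / r)).
  have := acos_ge0 ar; have := acos_lepi ar; have := pi_ge0 R; lra.
rewrite /cyl -/r addrC -[RHS]coordsK row3K /=.
rewrite mulr_natl sinD2pi cosD2pi cosN sinN cosE mulrN sinE ltr0_norm ?opprK//.
Qed.

Lemma measurable_sin_comp d (T : measurableType d) (f : T -> R) :
  measurable_fun setT f -> measurable_fun setT (fun x => sin (f x)).
Proof.
by apply: measurableT_comp; apply: continuous_measurable_fun; exact: continuous_sin.
Qed.

Lemma measurable_cos_comp d (T : measurableType d) (f : T -> R) :
  measurable_fun setT f -> measurable_fun setT (fun x => cos (f x)).
Proof.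
by apply: measurableT_comp; apply: continuous_measurable_fun; exact: continuous_cos.
Qed.

Lemma measurable_rotz : measurable_fun setT (fun p : R * borel_rV3 R => rotz p.1 p.2).
Proof.
have mc (i : R * R * R -> R) : measurable_fun setT i ->
    measurable_fun setT (fun p : R * borel_rV3 R => i (coords p.2)).
  by move=> mi; apply: measurableT_comp => //; apply: measurableT_comp => //;
    exact: measurable_coords.
have [m1 m2 m3] : [/\ measurable_fun setT (fun p : R * borel_rV3 R => (coords p.2).1.1),
    measurable_fun setT (fun p : R * borel_rV3 R => (coords p.2).1.2) &
    measurable_fun setT (fun p : R * borel_rV3 R => (coords p.2).2)].
  split; [apply: (mc (fun y => y.1.1))|apply: (mc (fun y => y.1.2))|exact: (mc snd)];
    exact: measurableT_comp.
have ms : measurable_fun setT (fun p : R * borel_rV3 R => sin p.1).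
  exact: measurable_sin_comp.
have mcos : measurable_fun setT (fun p : R * borel_rV3 R => cos p.1).
  exact: measurable_cos_comp.
apply: measurable_row3 => //.
  by apply: measurable_funB; exact: measurable_funM.
by apply: measurable_funD; exact: measurable_funM.
Qed.

Lemma measurable_cyl : measurable_fun setT (fun p : R * R => cyl p.1 p.2).
Proof.
have mr : measurable_fun setT (fun p : R * R => Num.sqrt (1 - p.1 ^+ 2)).
  apply: (measurableT_comp (f := @Num.sqrt R)).
    by apply: continuous_measurable_fun; exact: sqrt_continuous.
  by apply: measurable_funB => //; exact: measurable_funX.
by apply: measurable_row3 => //; apply: measurable_funM => //;
  [exact: measurable_cos_comp|exact: measurable_sin_comp].
Qed.

Lemma measurable_sphere2 : measurable (@sphere2 R : set (borel_rV3 R)).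
Proof.
rewrite (_ : @sphere2 R =
  ((fun y => y.1.1 ^+ 2 + y.1.2 ^+ 2 + y.2 ^+ 2) \o coords) @^-1` [set 1]).
  apply: measurable_preimage => //; apply: measurableT_comp; last exact: measurable_coords.
  apply: measurable_funD; last by apply: measurable_funX.
  by apply: measurable_funD; apply: measurable_funX; exact: measurableT_comp.
by apply/seteqP; split => x; rewrite /sphere2 /preimage /mkset inner_coords.
Qed.

(** The shift moves the window to []c, T + c]], whose part beyond [T] is the translate by one period
    of the missing part []0, c]]. *)
Lemma lebesgue_periodic (T c : R) (S : set R) : measurable S ->
  (forall x, S (x + T) <-> S x) -> 0 <= c <= T ->
  leb (`]0, T] `&` (fun x => x + c) @^-1` S) = leb (`]0, T] `&` S).
Proof.
move=> mS TS /andP[c0 cT].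
have shift a b d : leb (`]a + d, b + d] `&` S) =
    leb (`]a, b] `&` (fun x => x + d) @^-1` S).
  rewrite -(preserves_translation d).2; last exact: measurableI.
  by rewrite preimage_setI; congr (leb (_ `&` _)); apply/seteqP; split => x /=;
    rewrite !in_itv /= ltrD2r lerD2r.
have split_itv a b d : a <= b -> b <= d ->
    leb (`]a, d] `&` S) = (leb (`]a, b] `&` S) + leb (`]b, d] `&` S))%E.
  move=> ab bd; rewrite -measureU; [|exact: measurableI|exact: measurableI|].
    rewrite -setIUl; congr (leb (_ `&` _)); apply/seteqP.
    split => x /=; rewrite !in_itv /=.
      by move=> /andP[ax xd]; case: (leP x b) => xb; [left|right]; rewrite ?ax ?xd.
    by case=> /andP[h1 h2]; rewrite ?h1 ?h2 ?andbT ?(le_trans h2)//= (le_lt_trans ab).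
  apply/seteqP; split => x //= -[]; rewrite !in_itv /=.
  by move=> [/andP[_ xb] _] [/andP[bx _] _]; move: bx; rewrite ltNge xb.
rewrite -shift add0r (split_itv c T)// ?lerDl// (split_itv 0 c)// addeC.
congr (_ + _)%E; rewrite -[X in `]X, _]%classic]add0r [T + c]addrC shift.
by congr (leb (_ `&` _)); apply/seteqP; split => x /=; rewrite TS.
Qed.

(** Measured in angle, not in arc length, so that the slice at a pole counts for 0 or [2 * pi]. *)
Definition parallel_measure (A : set (borel_rV3 R)) (z : R) : \bar R :=
  leb (`]0, 2 * pi] `&` [set t | A (cyl z t)]).

Lemma measurable_parallel A : measurable A ->
  measurable_fun setT (parallel_measure A).
Proof.
move=> mA.
have mP : measurable ((setT `*` `]0, 2 * pi]) `&`
    ((fun p : R * R => cyl p.1 p.2) @^-1` A)).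
  apply: measurableI; first exact: measurableX.
  exact: measurable_preimage measurable_cyl mA.
have := measurable_fun_xsection leb mP.
congr (measurable_fun _ _); apply/funext => z /=; congr (leb _).
by apply/seteqP; split => t; rewrite /xsection /= inE /=; tauto.
Qed.

(** Both sides are the measure under [leb \x nu] of the pairs [(t, x)] with [rotz t x] in [A]: at
    fixed [t] the slice has measure [nu A] by invariance, at fixed [x] it is a shifted longitude
    slice of [A]. *)
Lemma rotz_invariant_average (nu : {finite_measure set (borel_rV3 R) -> \bar R}) A :
  nu (~` @sphere2 R) = 0%E ->
  (forall t B, 0 <= t <= 2 * pi -> measurable B -> nu (rotz t @^-1` B) = nu B) ->
  measurable A ->
  ((2 * pi)%:E * nu A = \int[nu]_x parallel_measure A (coords x).2)%E.
Proof.
move=> nuS nurot mA; have mS := measurable_sphere2.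
have mP : measurable ((`]0, 2 * pi] `*` setT) `&`
    ((fun p : R * borel_rV3 R => rotz p.1 p.2) @^-1` A)).
  apply: measurableI; first exact: measurableX.
  exact: measurable_preimage measurable_rotz mA.
set P := _ `&` _ in mP.
transitivity ((leb \x nu) P)%E.
  transitivity (\int[leb]_(t in `]0%R, (2 * pi)%R]) nu A)%E.
    rewrite integral_cst//= lebesgue_measure_itv /= lte_fin.
    by rewrite mulr_gt0 ?pi_gt0// sube0 muleC.
  rewrite integral_mkcond; apply: eq_integral => t _ /=; rewrite patchE.
  case: ifPn => [/set_mem t0|/negP t0].
    rewrite -(nurot t)//; last by move: t0; rewrite /= in_itv /= => /andP[/ltW -> ->].
    congr (nu _).
    by apply/seteqP; split => x; rewrite /xsection /P /= inE /=; tauto.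
  rewrite (_ : xsection P t = set0) ?measure0//.
  apply/seteqP; split => x //; rewrite /xsection /P /= inE /= => -[[t0' _] _].
  by apply: t0; exact: mem_set.
rewrite product_measureE2//.
have mG : measurable_fun setT (fun x : borel_rV3 R => parallel_measure A (coords x).2).
  apply: measurableT_comp; first exact: measurable_parallel.
  by apply: measurableT_comp => //; exact: measurable_coords.
have mSC : measurable (~` @sphere2 R : set (borel_rV3 R)) by exact: measurableC.
(* On the sphere every [x] is some [cyl z t]; the complement is null and is discarded before the
   integrands are compared. *)
rewrite (@ge0_negligible_integral _ _ _ nu setT (~` @sphere2 R))//; last first.
  exact: measurable_fun_ysection.
rewrite [RHS](@ge0_negligible_integral _ _ _ nu setT (~` @sphere2 R))//; last first.
rewrite setTD setCK; apply: eq_integral => x /set_mem Sx.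
have [t t0 xE] := cyl_sphere2 Sx.
rewrite /parallel_measure -(@lebesgue_periodic _ t)//.
- congr (leb _); apply/seteqP; split => u; rewrite /ysection /P /= inE /=;
    by rewrite -[rotz u x](congr1 (rotz u) xE) rotz_cyl addrC; tauto.
- apply: (@measurable_preimage _ _ _ _ (cyl (coords x).2) A) mA.
  apply: (@measurableT_comp _ _ _ _ _ _ (fun p : R * R => cyl p.1 p.2) _
    (fun t => ((coords x).2, t))); first exact: measurable_cyl.
  exact: measurable_fun_pair.
- by move=> u /=; rewrite cylD2pi.
Qed.

(** By [rotz_invariant_average] the measure of [A] is the integral of a function of the height
    alone, so only the laws of the height matter. These are determined by the half-lines []z, +oo[],
    which are stable under intersection. *)
Lemma rotz_invariant_unique (m1 m2 : {finite_measure set (borel_rV3 R) -> \bar R})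
    (c : {nonneg R}) :
  (forall t B, 0 <= t <= 2 * pi -> measurable B -> m1 (rotz t @^-1` B) = m1 B) ->
  (forall t B, 0 <= t <= 2 * pi -> measurable B -> m2 (rotz t @^-1` B) = m2 B) ->
  m1 (~` @sphere2 R) = 0%E -> m2 (~` @sphere2 R) = 0%E ->
  m1 (@sphere2 R) = (c%:num%:E * m2 (@sphere2 R))%E ->
  (forall z : R, -1 <= z < 1 -> m1 [set x | (z < (coords x).2)%R] =
    (c%:num%:E * m2 [set x | (z < (coords x).2)%R])%E) ->
  forall A, measurable A -> m1 A = (c%:num%:E * m2 A)%E.
Proof.
move=> r1 r2 s1 s2 eqS eqz A mA.
have m3 : measurable_fun setT (fun x : borel_rV3 R => (coords x).2).
  by apply: measurableT_comp => //; exact: measurable_coords.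
have mz z : measurable [set x : borel_rV3 R | z < (coords x).2].
  rewrite (_ : [set x | _] = (fun x => (coords x).2) @^-1` `]z, +oo[).
    exact: measurable_preimage.
  by apply/seteqP; split => x /=; rewrite in_itv /= andbT.
have S1 (x : borel_rV3 R) : sphere2 x -> -1 <= (coords x).2 <= 1.
  rewrite /sphere2 /mkset inner_coords; case: (coords x) => [[a b] z] /= abz.
  by apply/andP; split; nra.
have onS (m : {finite_measure set (borel_rV3 R) -> \bar R}) X :
    m (~` @sphere2 R) = 0%E -> measurable X -> m X = m (X `&` @sphere2 R).
  move=> mS0 mX; have mS := measurable_sphere2.
  rewrite (measureDI m mX mS).
  rewrite (@subset_measure0 _ _ _ m (X `\` @sphere2 R) (~` @sphere2 R)) ?add0e//;
    first [exact: measurableD|exact: measurableC|by move=> x []].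
(* Up to null sets the cap above [z] is the whole sphere for [z < -1] and empty for [z >= 1]. *)
have {}eqz z : m1 [set x | (z < (coords x).2)%R] =
    (c%:num%:E * m2 [set x | (z < (coords x).2)%R])%E.
  have [z1|z1] := ltP z (-1).
    rewrite (onS m1)// (onS m2)//; rewrite (_ : _ `&` _ = @sphere2 R)//.
    by apply/setIidPr => x /S1/andP[x1 _] /=; exact: lt_le_trans x1.
  have [z2|z2] := ltP z 1; first by rewrite eqz// z1.
  rewrite (onS m1)// (onS m2)//; rewrite (_ : _ `&` _ = set0) ?measure0 ?mule0//.
  by apply/seteqP; split => x //= [zx /S1/andP[_]]; rewrite leNgt (le_lt_trans z2 zx).
have pi20 : (0 < 2 * pi :> R) by rewrite mulr_gt0 ?pi_gt0.
suff : ((2 * pi)%:E * m1 A = c%:num%:E * ((2 * pi)%:E * m2 A))%E.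
  move=> h; have := congr1 (fun x => ((2 * pi)^-1%:E * x)%E) h.
  rewrite muleA -!EFinM mulVf ?gt_eqF// mul1e => ->.
  by rewrite muleCA [X in (_ * X)%E]muleA -EFinM mulVf ?gt_eqF// mul1e.
rewrite !rotz_invariant_average//.
pose f := fun x : borel_rV3 R => (coords x).2.
pose p (m : {finite_measure set (borel_rV3 R) -> \bar R}) :
  {measure set R -> \bar R} := pushforward m f.
have mpar := measurable_parallel mA.
transitivity (\int[p m3 m1]_z parallel_measure A z)%E.
  by rewrite ge0_integral_pushforward.
transitivity (c%:num%:E * \int[p m3 m2]_z parallel_measure A z)%E; last first.
  by rewrite ge0_integral_pushforward.
pose p2 : {measure set R -> \bar R} := mscale c (p m3 m2).
rewrite -(ge0_integral_mscale (p m3 m2))//.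
apply: (eq_measure_integral p2) => B mB _.
have mE : @measurable default_measure_display R = <<s @RGenOInfty.G R >>.
  exact: RGenOInfty.measurableE.
refine (@measure_unique default_measure_display R R _ (fun n => `]- n%:R, +oo[%classic) mE _ _ _
  (p m3 m1) p2 _ _ B mB) => //.
- move=> _ _ [a ->] [b ->]; exists (Num.max a b); apply/seteqP.
  by split => x /=; rewrite !in_itv /= !andbT gt_max => /andP.
- by move=> n; exists (- n%:R).
- rewrite -subTset => x _; exists (Num.bound `|x|) => //=.
  by rewrite in_itv /= andbT ltrNl (le_lt_trans (ler_norm _))// normrN archi_boundP.
- move=> _ [a ->]; have := eqz a; rewrite /p2 /mscale /= /p /pushforward.
  by congr (m1 _ = _ * m2 _)%E; apply/seteqP; split => x /=; rewrite in_itv /= andbT.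
- move=> n; rewrite /p /pushforward /= ltey_eq fin_num_measure//.
  exact: measurable_preimage.
Qed.

End rotation_invariance.

(** * The surface measure *)

Section surface_measure.
Context {R : realType}.
Local Notation leb := (@lebesgue_measure R).

Lemma spherical_cyl (t u : R) : 0 <= t <= pi -> spherical (t, u) = cyl (cos t) u.
Proof.
move=> tpi; rewrite /spherical /cyl /row3 /= -sin2cos2 sqrtr_sqr ger0_norm//.
by rewrite sin_ge0_pi.
Qed.

(** Reconciles the closed longitude range of [spherical_dom] with the half-open one of
    [parallel_measure]. *)
Lemma lebesgue_itv_oc (a b : R) (S : set R) : measurable S ->
  leb (`[a, b] `&` S) = leb (`]a, b] `&` S).
Proof.
move=> mS; have [mc mo] : measurable (`[a, b] `&` S) /\ measurable (`]a, b] `&` S).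
  by split; exact: measurableI.
apply/eqP; rewrite eq_le; apply/andP; split; last first.
  apply: le_measure; rewrite ?inE//.
  by apply: setSI; apply: subset_itvr; rewrite bnd_simp.
rewrite -(@measureU0 _ _ _ leb (`]a, b] `&` S) [set a])//; last exact: lebesgue_measure_set1.
apply: le_measure; rewrite ?inE//; first exact: measurableU.
move=> x [/= + Sx]; rewrite in_itv /= => /andP[ax xb].
have [->|xa] := eqVneq x a; [by right|left; split => //=].
by rewrite in_itv /= xb lt_neqAle eq_sym xa ax.
Qed.

(** Tonelli in spherical coordinates: the density does not depend on the longitude and leaves the
    inner integral. *)
Lemma sphere_measureE (A : set (borel_rV3 R)) : measurable A ->
  sphere_measure A =
  (\int[leb]_(t in `[0%R, pi]) ((sin t / (4 * pi))%:E * parallel_measure A (cos t)))%E.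
Proof.
move=> mA; rewrite /sphere_measure integral_mkcond.
set D := @spherical_dom R `&` _.
have mD : measurable D.
  apply: measurableI; first exact: measurable_spherical_dom.
  exact: measurable_preimage (@measurable_spherical R) mA.
pose f (p : R * R) := (sin p.1 / (4 * pi))%:E.
have mf : measurable_fun setT (f \_ D).
  apply/(measurable_restrictT _ mD); apply: measurable_funTS.
  by apply/measurable_EFinP; apply: measurable_funM => //; exact: measurable_sin_comp.
have f0 p : (0 <= (f \_ D) p)%E.
  rewrite patchE; case: ifPn => // /set_mem[[+ _] _]; rewrite /= in_itv /= => p1.
  by rewrite lee_fin divr_ge0 ?mulr_ge0 ?pi_ge0// sin_ge0_pi.
rewrite (@fubini_tonelli1 _ _ _ _ _ leb leb _ mf f0) /fubini_F /=.
rewrite [RHS]integral_mkcond; apply: eq_integral => t _.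
rewrite patchE; case: ifPn => [/set_mem/= t0|/negP t0]; last first.
  apply: integral0_eq => u _; rewrite patchE; case: ifPn => // /set_mem[[/= t0' _] _].
  by case: t0; exact: mem_set.
have mS : measurable [set u | A (cyl (cos t) u)].
  apply: (@measurable_preimage _ _ _ _ (cyl (cos t)) A) mA.
  apply: (@measurableT_comp _ _ _ _ _ _ (fun p : R * R => cyl p.1 p.2) _
    (fun u => (cos t, u))); first exact: measurable_cyl.
  exact: measurable_fun_pair.
rewrite /parallel_measure -lebesgue_itv_oc//.
rewrite -integral_cst; last exact: measurableI.
rewrite [RHS]integral_mkcond; apply: eq_integral => u _; rewrite !patchE.
congr (if _ then _ else _); apply/idP/idP => /set_mem.
  move=> [[_ /= u0] Au]; apply: mem_set; split => //=.
  by move: Au; rewrite /preimage /= spherical_cyl// -in_itv.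
move=> [/= u0 Au]; apply: mem_set; split; first by split.
by rewrite /preimage /= spherical_cyl.
Qed.

Lemma sphere_measure_rotz t (A : set (borel_rV3 R)) : 0 <= t <= 2 * pi ->
  measurable A -> sphere_measure (rotz t @^-1` A) = sphere_measure A.
Proof.
move=> t0 mA; have mr : measurable_fun setT (rotz t : borel_rV3 R -> borel_rV3 R).
  apply: (@measurableT_comp _ _ _ _ _ _ (fun p : R * borel_rV3 R => rotz p.1 p.2) _
    (fun x => (t, x))); first exact: measurable_rotz.
  exact: measurable_fun_pair.
rewrite !sphere_measureE//; last exact: measurable_preimage.
apply: eq_integral => u _; congr (_ * _)%E.
rewrite /parallel_measure -[RHS](@lebesgue_periodic _ _ t)//.
- by congr (leb _); apply/seteqP; split => w /=; rewrite rotz_cyl.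
- apply: (@measurable_preimage _ _ _ _ (cyl (cos u)) A) mA.
  apply: (@measurableT_comp _ _ _ _ _ _ (fun p : R * R => cyl p.1 p.2) _
    (fun w => (cos u, w))); first exact: measurable_cyl.
  exact: measurable_fun_pair.
- by move=> w /=; rewrite cylD2pi.
Qed.

Lemma sphere_measureC : sphere_measure (~` @sphere2 R) = 0%E.
Proof.
rewrite /sphere_measure (_ : _ `&` _ = set0) ?integral_set0//.
apply/seteqP; split => // p [[+ _]]; rewrite /= in_itv /= => p1; apply.
case: p p1 => t u /= /spherical_cyl ->.
rewrite /sphere2 /mkset inner_row3 !expr2 -!expr2 !exprMn -mulrDr cos2Dsin2 mulr1.
by rewrite -sin2cos2 sqrtr_sqr real_normK ?num_real// sin2cos2 subrK.
Qed.

(** Archimedes' theorem: the area density [sin] is minus the derivative of the height [cos], so area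
    is proportional to height. *)
Lemma sphere_measure_cap (z : R) : -1 <= z < 1 ->
  sphere_measure [set x : borel_rV3 R | (z < (coords x).2)%R] = ((1 - z) / 2)%:E.
Proof.
move=> /andP[z1 z2].
have zacos : -1 <= z <= 1 by rewrite z1 ltW.
have zac : z \in `[-1, 1] by rewrite in_itv.
have mz : measurable [set x : borel_rV3 R | (z < (coords x).2)%R].
  rewrite (_ : [set x | _] = (fun x => (coords x).2) @^-1` `]z, +oo[).
    apply: measurable_preimage => //.
    by apply: measurableT_comp => //; exact: measurable_coords.
  by apply/seteqP; split => x /=; rewrite in_itv /= andbT.
rewrite sphere_measureE//.
have pi0 : (pi : R) != 0 by rewrite gt_eqF// pi_gt0.
have a0 : 0 < acos z by rewrite acos_gt0// z1.
have api := acos_lepi zacos.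
transitivity (\int[leb]_(t in `[0%R, acos z]) (sin t / 2)%:E)%E; last first.
  have dF (x : R) : is_derive x 1 (fun x : R => - cos x / 2) (sin x / 2).
    apply: is_derive_eq.
    by rewrite !scaler0 add0r opprK [RHS]mulrC.
  rewrite (@continuous_FTC2 _ _ (fun x => - cos x / 2))//.
  - by rewrite acosK// cos0 -EFinB; congr (_%:E); field.
  - apply: continuous_subspaceT => x.
    by apply: cvgM; [exact: continuous_sin|exact: cvg_cst].
  - split.
    + by move=> x _; exact: ex_derive.
    + apply: cvg_at_right_filter; apply: cvgM; last exact: cvg_cst.
      by apply: cvgN; exact: continuous_cos.
    + apply: cvg_at_left_filter; apply: cvgM; last exact: cvg_cst.
      by apply: cvgN; exact: continuous_cos.
  - by move=> x _; rewrite derive1E derive_val.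
(* The strict inequality [z < cos t] means [t < acos z], so the null endpoint [acos z] is
   dropped. *)
rewrite -[RHS]integral_itv_bndo_bndc; last first.
  apply: measurable_funTS; apply/measurable_EFinP.
  by apply: measurable_funM => //; exact: measurable_sin_comp.
rewrite integral_mkcond [RHS]integral_mkcond; apply: eq_integral => t _.
rewrite !patchE /parallel_measure.
have [|tn] := boolP (t \in `[0, pi]%classic); last first.
  rewrite ifF//; apply/negbTE; apply: contra tn; rewrite !inE /= !in_itv /=.
  by move=> /andP[-> /ltW/le_trans ->].
rewrite inE /= => tpi.
have E : (z < cos t) = (t < acos z).
  by rewrite -{1}(acosK zac) ltr_cos// in_itv/= acos_ge0.
have -> : [set u | [set x : borel_rV3 R | (z < (coords x).2)%R] (cyl (cos t) u)] =
    [set _ | t < acos z].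
  by apply/funext => u; rewrite /mkset row3K /= E.
rewrite [X in if X then _ else _](_ : _ = (t < acos z)); last first.
  by apply/idP/idP; rewrite inE /= in_itv /=; move: tpi; rewrite in_itv /= => /andP[->].
case: ifPn => ta.
  rewrite (_ : _ `&` _ = `]0, 2 * pi]%classic); last by apply/setIidPl => u.
  rewrite lebesgue_measure_itv /= lte_fin mulr_gt0 ?pi_gt0//.
  rewrite sube0 -EFinM; congr (_%:E).
  by move: (pi : R) (sin t) pi0 => p s p0; field.
rewrite (_ : _ `&` _ = set0) ?measure0 ?mule0//.
by apply/seteqP; split => u // -[_].
Qed.

End surface_measure.

(** * Discs and the unit ball of the quaternions *)

Section discs.
Context {R : realType}.
Local Notation leb := (@lebesgue_measure R).
Local Notation leb2 := (@leb2 R).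
Local Notation leb4 := (@leb4 R).

Lemma ge0_integral_scaling d (T : measurableType d) (mu : {measure set T -> \bar R})
    (f : T -> T) (k : {nonneg R}) (g : T -> \bar R) :
  measurable_fun setT f ->
  (forall A, measurable A -> mu (f @^-1` A) = (k%:num%:E * mu A)%E) ->
  measurable_fun setT g -> (forall x, 0 <= g x)%E ->
  (\int[mu]_x g (f x) = k%:num%:E * \int[mu]_x g x)%E.
Proof.
move=> mf fmu mg g0.
transitivity (\int[pushforward mu f]_x g x)%E.
  by rewrite ge0_integral_pushforward.
rewrite -ge0_integral_mscale//.
by apply: eq_measure_integral => A mA _; exact: fmu.
Qed.

(** One factor [k^-1] comes from the sections, the other from the integral over the first
    coordinate. *)
Lemma leb2_scaling (k : R) A : 0 < k -> measurable A ->
  leb2 ((fun z => (k * z.1, k * z.2)) @^-1` A) = ((k ^+ 2)^-1%:E * leb2 A)%E.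
Proof.
move=> k0 mA.
have lin : measurable_fun setT (fun x : measurableTypeR R => k * x : measurableTypeR R).
  exact: measurable_funM.
have linE B : measurable B -> leb ((fun x => k * x) @^-1` B) = (k^-1%:E * leb B)%E.
  move=> mB; rewrite -(lebesgue_measure_affine 0 k0 mB); congr (leb _).
  by apply/seteqP; split => x /=; rewrite addr0.
have k0' : 0 <= k^-1 by rewrite invr_ge0 ltW.
transitivity (\int[leb]_x (k^-1%:E * leb (xsection A (k * x)%R)))%E.
  apply: eq_integral => x _ /=; rewrite -linE; last exact: measurable_xsection.
  by congr (leb _); apply/seteqP; split => y; rewrite /xsection /= !inE.
have mx : measurable_fun setT (leb \o xsection A) by exact: measurable_fun_xsection.
rewrite (@ge0_integral_scaling _ _ leb (fun x => k * x) (NngNum k0')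
  (fun x => k^-1%:E * leb (xsection A x))%E)//=.
- rewrite ge0_integralZl//; first by rewrite muleA -EFinM -invfM -expr2.
- exact: measurable_funeM.
- by move=> x; rewrite mule_ge0.
Qed.

Lemma leb2X (A B : set (measurableTypeR R)) : measurable A -> measurable B ->
  leb2 (A `*` B) = (leb A * leb B)%E.
Proof. exact: product_measure1E. Qed.

Lemma leb4X (A B : set (measurableTypeR R * measurableTypeR R)) :
  measurable A -> measurable B -> leb4 (A `*` B) = (leb2 A * leb2 B)%E.
Proof. exact: product_measure1E. Qed.

Definition nsq (z : R * R) : R := z.1 ^+ 2 + z.2 ^+ 2.

Lemma nsq_ge0 z : 0 <= nsq z.
Proof. by rewrite addr_ge0 ?sqr_ge0. Qed.

Lemma measurable_nsq : measurable_fun setT nsq.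
Proof. by apply: measurable_funD; apply: measurable_funX. Qed.

(** The parameter [r] is the squared radius, which makes areas linear in it. *)
Definition disc (r : R) : set (measurableTypeR R * measurableTypeR R) :=
  [set z | nsq z <= r].

Lemma measurable_disc r : measurable (disc r).
Proof.
rewrite (_ : disc r = nsq @^-1` `]-oo, r]).
  exact: measurable_preimage measurable_nsq _.
by apply/seteqP; split => x /=; rewrite in_itv.
Qed.

Lemma leb2_disc1_fin : leb2 (disc 1) \is a fin_num.
Proof.
have : (leb2 (disc 1) <= leb2 (`[(-1)%R, 1%R] `*` `[(-1)%R, 1%R]))%E.
  apply: le_measure; rewrite ?inE; [exact: measurable_disc|exact: measurableX|].
  move=> -[a b]; rewrite /disc /nsq /= => ab; split => /=; rewrite in_itv /=;
    apply/andP; split; nra.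
rewrite leb2X// lebesgue_measure_itv /= => h.
rewrite ge0_fin_numE//; apply: le_lt_trans h _.
by case: ifP => _; rewrite -?EFinB -EFinM ltry.
Qed.

(** Scaling by the square root of [r], with [r = 0] apart because the scaling degenerates there. The
    constant [leb2 (disc 1)] is never evaluated. *)
Lemma leb2_disc r : 0 <= r -> leb2 (disc r) = (r%:E * leb2 (disc 1))%E.
Proof.
rewrite le_eqVlt => /predU1P[<-|r0].
  rewrite mul0e; apply: (@subset_measure0 _ _ _ leb2 _ ([set 0] `*` [set 0])).
  - exact: measurable_disc.
  - exact: measurableX.
  - move=> -[a b]; rewrite /disc /nsq /= => ab.
    have : a ^+ 2 + b ^+ 2 == 0 by rewrite eq_le ab addr_ge0 ?sqr_ge0.
    by rewrite paddr_eq0 ?sqr_ge0// !sqrf_eq0 => /andP[/eqP -> /eqP ->].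
  - by apply: (eq_trans (leb2X _ _)) => //; rewrite lebesgue_measure_set1 mul0e.
have s0 : 0 < Num.sqrt r by rewrite sqrtr_gt0.
have := leb2_scaling s0 (measurable_disc r).
rewrite sqr_sqrtr ?ltW// (_ : _ @^-1` _ = disc 1) => [->|].
  by rewrite muleA -EFinM divff ?gt_eqF// mul1e.
have E a b : (Num.sqrt r * a) ^+ 2 + (Num.sqrt r * b) ^+ 2 <= r = (a ^+ 2 + b ^+ 2 <= 1).
  by rewrite !exprMn sqr_sqrtr ?(ltW r0)// -mulrDr -[leRHS]mulr1 ler_pM2l.
by apply/seteqP; split => -[a b]; rewrite /disc /nsq /= E.
Qed.

Lemma leb2_annulus r r' : 0 <= r <= r' ->
  leb2 (disc r' `\` disc r) = ((r' - r)%:E * leb2 (disc 1))%E.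
Proof.
move=> /andP[r0 rr']; have r'0 := le_trans r0 rr'.
have [mr mr'] := (measurable_disc r, measurable_disc r').
have fin : (leb2 (disc r') < +oo)%E.
  by rewrite (leb2_disc r'0) ltey_eq fin_numM// leb2_disc1_fin.
rewrite (@measureD _ _ _ leb2 _ _ mr' mr fin) (_ : disc r' `&` disc r = disc r).
  by rewrite /= (leb2_disc r0) (leb2_disc r'0) EFinB muleBl// leb2_disc1_fin.
by apply/setIidPr => z /= zr; exact: le_trans zr rr'.
Qed.

(** The origin is left out so that [nsq4 q] is invertible on the ball. *)
Definition ball4 : set ((measurableTypeR R * measurableTypeR R) *
    (measurableTypeR R * measurableTypeR R)) :=
  [set q | 0 < nsq q.1 + nsq q.2 <= 1].

Lemma measurable_nsq4 : measurable_fun setT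
  (fun q : (measurableTypeR R * measurableTypeR R) *
    (measurableTypeR R * measurableTypeR R) => nsq q.1 + nsq q.2).
Proof.
by apply: measurable_funD; apply: (measurableT_comp measurable_nsq).
Qed.

Lemma measurable_ball4 : measurable ball4.
Proof.
rewrite (_ : ball4 = (fun q => nsq q.1 + nsq q.2) @^-1` `]0, 1]).
  exact: measurable_preimage measurable_nsq4 _.
by apply/seteqP; split => x /=; rewrite in_itv.
Qed.

Lemma leb4_ball4_fin : leb4 ball4 \is a fin_num.
Proof.
have : (leb4 ball4 <= leb4 (disc 1 `*` disc 1))%E.
  apply: le_measure; rewrite ?inE; [exact: measurable_ball4| |].
    by apply: measurableX; exact: measurable_disc.
  move=> -[z w] /= /andP[_ zw]; split; apply: le_trans zw.
    by rewrite lerDl nsq_ge0.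
  by rewrite lerDr nsq_ge0.
rewrite leb4X; [move=> h|exact: measurable_disc|exact: measurable_disc].
rewrite ge0_fin_numE//; apply: le_lt_trans h _.
by rewrite ltey_eq fin_numM// leb2_disc1_fin.
Qed.

Lemma leb4_ball4_gt0 : (0 < leb4 ball4)%E.
Proof.
pose I : set (measurableTypeR R) := `]0, 2^-1]%classic.
have mI : measurable I by exact: measurable_itv.
have mII := measurableX mI mI.
have leI : leb I = (2^-1)%:E.
  by rewrite /I lebesgue_measure_itv /= lte_fin invr_gt0 ltr0n sube0.
apply: (@lt_le_trans _ _ (leb4 ((I `*` I) `*` (I `*` I)))).
  rewrite leb4X; [|exact: mII|exact: mII].
  by rewrite leb2X//= leI -!EFinM lte_fin !mulr_gt0 ?invr_gt0.
apply: le_measure; rewrite ?inE; [|exact: measurable_ball4|].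
  exact: measurableX.
move=> -[[a b] [c d]] [[/=]]; rewrite /I /= !in_itv /=.
move=> /andP[a0 a1] /andP[b0 b1] [/andP[c0 c1] /andP[d0 d1]].
have half (x : R) : 0 < x -> x <= 2^-1 -> 0 < x ^+ 2 <= 4^-1.
  by move=> x0 x1; rewrite exprn_gt0//=; nra.
have /andP[? ?] := half _ a0 a1; have /andP[? ?] := half _ b0 b1.
have /andP[? ?] := half _ c0 c1; have /andP[? ?] := half _ d0 d1.
by rewrite /ball4 /nsq /=; apply/andP; split; lra.
Qed.

(** The area of the slice of [ball4] over a second coordinate of squared norm [x]. *)
Definition cone (x : R) : \bar R := ((Num.max 0 (1 - x))%:E * leb2 (disc 1))%E.

Lemma leb4_ball4 : leb4 ball4 = (\int[leb2]_w cone (nsq w))%E.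
Proof.
rewrite /leb4 product_measureE2; last exact: measurable_ball4.
apply: eq_integral => w _; rewrite /cone.
have [w1|w1] := ltP 1 (nsq w).
  rewrite max_l ?mul0e; last by rewrite subr_le0 ltW.
  rewrite (_ : ysection _ _ = set0) ?measure0//.
  apply/seteqP; split => z //; rewrite /ysection /= inE /ball4 /= => /andP[_].
  by rewrite leNgt (lt_le_trans w1)// lerDr nsq_ge0.
rewrite max_r ?subr_ge0//.
(* Over [w = 0] the slice is the punctured disc, that is [disc 1] without [disc 0]. *)
have [w0|w0] := eqVneq (nsq w) 0.
  rewrite w0 -leb2_annulus ?lexx ?ler01//; congr (leb2 _).
  apply/seteqP; split => z; rewrite /ysection /disc /= inE /ball4 /= w0 addr0.
    by move=> /andP[z0 z1]; split => //; apply/negP; rewrite -ltNge.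
  by move=> [-> /negP]; rewrite -ltNge => ->.
have {}w0 : 0 < nsq w by rewrite lt0r w0 nsq_ge0.
rewrite -leb2_disc ?subr_ge0//; congr (leb2 _).
apply/seteqP; split => z; rewrite /ysection /disc /= inE /ball4 /= lerBrDr.
  by move=> /andP[].
by move=> ->; rewrite andbT ltr_wpDl ?nsq_ge0.
Qed.

(* Integrating the area c (1 - nsq w / k) of an annulus over the second complex
   coordinate [w], the scaling w |-> sqrt k w brings out the factor [k]. *)
Lemma leb4_cap (k : R) : 0 < k <= 1 ->
  leb4 (ball4 `&` [set q | nsq q.2 * (1 - k) < nsq q.1 * k]) = (k%:E * leb4 ball4)%E.
Proof.
move=> /andP[k0 k1]; have s0 : 0 < Num.sqrt k by rewrite sqrtr_gt0.
have mC : measurable (ball4 `&` [set q | nsq q.2 * (1 - k) < nsq q.1 * k]).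
  apply: measurableI; first exact: measurable_ball4.
  rewrite (_ : [set q | _] = (fun q => nsq q.1 * k - nsq q.2 * (1 - k)) @^-1` `]0, +oo[).
    apply: measurable_preimage => //; apply: measurable_funB;
    by apply: measurable_funM => //; apply: (measurableT_comp measurable_nsq).
  by apply/seteqP; split => q /=; rewrite in_itv /= andbT subr_gt0.
transitivity (\int[leb2]_w cone (nsq w / k))%E.
  rewrite /leb4 product_measureE2//; apply: eq_integral => w _; rewrite /cone.
  have [wk|wk] := leP (nsq w) k.
    rewrite max_r; last by rewrite subr_ge0 ler_pdivrMr// mul1r.
    (* The slice over [w] is the annulus between the squared radii [nsq w * (1 - k) / k] and
       [1 - nsq w]. *)
    have -> : 1 - nsq w / k = (1 - nsq w) - nsq w * (1 - k) / k.
      by field; rewrite gt_eqF.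
    rewrite -leb2_annulus; last first.
      rewrite divr_ge0 ?mulr_ge0 ?nsq_ge0 ?subr_ge0 ?(ltW k0)//=.
      by rewrite ler_pdivrMr//; nra.
    congr (leb2 _); apply/seteqP; split => z; rewrite /ysection /disc /= inE /ball4 /=.
      move=> [/andP[_ zw] h]; split; first by rewrite lerBrDr.
      by apply/negP; rewrite -ltNge ltr_pdivrMr.
    rewrite lerBrDr => -[zw /negP]; rewrite -ltNge ltr_pdivrMr// => h.
    split => //; rewrite zw andbT ltr_wpDr ?nsq_ge0// -(pmulr_lgt0 _ k0).
    by rewrite (le_lt_trans _ h)// mulr_ge0 ?nsq_ge0 ?subr_ge0.
  rewrite max_l ?mul0e; last by rewrite subr_le0 ler_pdivlMr// mul1r ltW.
  rewrite (_ : ysection _ _ = set0) ?measure0//.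
  apply/seteqP; split => z //; rewrite /ysection /= inE /ball4 /= => -[/andP[_ zw] h].
  have := nsq_ge0 z; nra.
rewrite leb4_ball4.
have ik0 : 0 <= k by exact: ltW.
have ssk : (Num.sqrt k) ^+ 2 = k by rewrite sqr_sqrtr ?ltW.
have is0 : 0 < (Num.sqrt k)^-1 by rewrite invr_gt0.
have mcone : measurable_fun setT (fun w => cone (nsq w)).
  rewrite (_ : (fun w => _) = fun w =>
    (leb2 (disc 1) * (Num.max 0 (1 - nsq w))%:E)%E); last first.
    by apply/funext => w; rewrite muleC.
  apply: measurable_funeM; apply/measurable_EFinP; apply: measurable_maxr => //.
  by apply: measurable_funB => //; exact: measurable_nsq.
rewrite -(@ge0_integral_scaling _ _ leb2 (fun w => ((Num.sqrt k)^-1 * w.1,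
  (Num.sqrt k)^-1 * w.2)) (NngNum ik0) (fun w => cone (nsq w)))//=.
- apply: eq_integral => w _; congr cone; rewrite /nsq /= !exprMn exprVn ssk.
  by rewrite -mulrDr mulrC.
- by apply: measurable_fun_pair; apply: measurable_funM.
- by move=> A mA; rewrite leb2_scaling// exprVn ssk invrK.
- by move=> w; rewrite mule_ge0// lee_fin le_max lexx.
Qed.

End discs.

(** * The direction of a randomly rotated vector *)

Section restricted_law.
Context d d' (T : measurableType d) (T' : measurableType d') (R : realType).
Variables (mu : {measure set T -> \bar R}) (D : set T) (f : T -> T').
Hypotheses (mD : measurable D) (muD : mu D \is a fin_num) (mf : measurable_fun setT f).

Definition restricted_law (A : set T') : \bar R := mu (f @^-1` A `&` D).

Let law0 : restricted_law set0 = 0%E.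
Proof. by rewrite /restricted_law preimage_set0 set0I measure0. Qed.

Let law_ge0 A : (0 <= restricted_law A)%E.
Proof. exact: measure_ge0. Qed.

Let law_sigma_additive : semi_sigma_additive restricted_law.
Proof.
pose m : {measure set T' -> \bar R} :=
  pushforward (mrestr mu mD) f.
exact (@measure_semi_sigma_additive _ _ _ (m mf)).
Qed.

HB.instance Definition _ := isMeasure.Build _ _ _ restricted_law
  law0 law_ge0 law_sigma_additive.

Let law_fin : fin_num_fun restricted_law.
Proof.
move=> A mA; have mfA := measurable_preimage mf mA.
rewrite ge0_fin_numE//; apply: (@le_lt_trans _ _ (mu D)); last by rewrite ltey_eq muD.
by apply: le_measure; rewrite ?inE//; exact: measurableI.
Qed.

HB.instance Definition _ := Measure_isFinite.Build _ _ _ restricted_law law_fin.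

Definition finite_law : {finite_measure set T' -> \bar R} := restricted_law.

End restricted_law.

Section random_rotation.
Context {R : realType}.
Local Notation leb2 := (@leb2 R).
Local Notation leb4 := (@leb4 R).
Local Notation H := ((measurableTypeR R * measurableTypeR R) *
    (measurableTypeR R * measurableTypeR R))%type.

(* The vector q v q^* for the quaternion q = a + b i + c j + d k. It is stored as
   ((a, d), (b, c)) because q = z1 + z2 i with z1 = a + d k and z2 = b + c k, and
   right multiplication is linear in (z1, z2) over the field of the a + d k. *)
Definition qconj (v : R * R * R) (q : H) : R * R * R :=
  let: ((a, d), (b, c)) := q in let: (x, y, z) := v in
  (((a ^+ 2 + b ^+ 2) - (c ^+ 2 + d ^+ 2)) * x + 2 * (b * c - a * d) * y
     + 2 * (b * d + a * c) * z,
   2 * (b * c + a * d) * x + ((a ^+ 2 + c ^+ 2) - (b ^+ 2 + d ^+ 2)) * y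
     + 2 * (c * d - a * b) * z,
   2 * (b * d - a * c) * x + 2 * (c * d + a * b) * y
     + ((a ^+ 2 + d ^+ 2) - (b ^+ 2 + c ^+ 2)) * z).

Definition nsq4 (q : H) : R := nsq q.1 + nsq q.2.

(** Division by the squared norm turns [q v q^*] into [q v q^-1]. *)
Definition dir (v : R * R * R) (q : H) : borel_rV3 R :=
  row3 ((qconj v q).1.1 / nsq4 q) ((qconj v q).1.2 / nsq4 q) ((qconj v q).2 / nsq4 q).

Definition dot (u v : R * R * R) : R := u.1.1 * v.1.1 + u.1.2 * v.1.2 + u.2 * v.2.

(** Conjugation multiplies inner products by [nsq4 q ^+ 2]. The quotient stays unsimplified so that
    [q = 0] is covered, where the inverse is 0 by convention. *)
Lemma inner_dir u v q :
  inner (dir u q) (dir v q) = nsq4 q ^+ 2 * dot u v / nsq4 q ^+ 2.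
Proof.
rewrite inner_row3 ![_ / _ * _]mulrACA -!mulrDl -invfM -expr2; congr (_ / _).
move: u v q => [[x y] z] [[x' y'] z'] [[a d] [b c]].
by rewrite /nsq4 /nsq /dot /=; ring.
Qed.

Lemma measurable_invr : measurable_fun setT (fun x : R => x^-1).
Proof.
rewrite -(setUv [set 0]); apply/measurable_funU => //; first exact: measurableC.
split; first exact: measurable_fun_set1.
apply: open_continuous_measurable_fun.
  by apply: closed_openC; exact: closed_eq.
by move=> x; rewrite inE => /eqP x0; apply: cvgV.
Qed.

Lemma measurable_qconj d0 (T : measurableType d0) (a b c d i : T -> R) x y z :
  measurable_fun setT a -> measurable_fun setT b -> measurable_fun setT c ->
  measurable_fun setT d -> measurable_fun setT i ->
  measurable_fun setT (fun q => let w := qconj (x, y, z) ((a q, d q), (b q, c q)) in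
    row3 (w.1.1 * i q) (w.1.2 * i q) (w.2 * i q)).
Proof.
have sq (f g h k : T -> R) : measurable_fun setT f -> measurable_fun setT g ->
    measurable_fun setT h -> measurable_fun setT k ->
    measurable_fun setT (fun q => (f q ^+ 2 + g q ^+ 2) - (h q ^+ 2 + k q ^+ 2)).
  by move=> mf mg mh mk; apply: measurable_funB; apply: measurable_funD;
    exact: measurable_funX.
have cD (f g h k : T -> R) : measurable_fun setT f -> measurable_fun setT g ->
    measurable_fun setT h -> measurable_fun setT k ->
    measurable_fun setT (fun q => 2 * (f q * g q + h q * k q)).
  by move=> mf mg mh mk; apply: measurable_funM => //; apply: measurable_funD;
    exact: measurable_funM.
have cB (f g h k : T -> R) : measurable_fun setT f -> measurable_fun setT g ->
    measurable_fun setT h -> measurable_fun setT k ->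
    measurable_fun setT (fun q => 2 * (f q * g q - h q * k q)).
  by move=> mf mg mh mk; apply: measurable_funM => //; apply: measurable_funB;
    exact: measurable_funM.
move=> ma mb mc md mi /=.
have lin (f g h : T -> R) : measurable_fun setT f -> measurable_fun setT g ->
    measurable_fun setT h ->
    measurable_fun setT (fun q => (f q * x + g q * y + h q * z) * i q).
  by move=> mf mg mh; apply: measurable_funM => //; apply: measurable_funD;
    [apply: measurable_funD|]; exact: measurable_funM.
by apply: measurable_row3; apply: lin; do ?[exact: sq|exact: cB|exact: cD].
Qed.

Lemma measurable_dir v : measurable_fun setT (dir v).
Proof.
have mN : measurable_fun setT (fun q : H => (nsq4 q)^-1).
  by apply: (measurableT_comp measurable_invr); exact: measurable_nsq4.
have m1 : measurable_fun setT (fun q : H => q.1.1) by exact: measurableT_comp.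
have m2 : measurable_fun setT (fun q : H => q.1.2) by exact: measurableT_comp.
have m3 : measurable_fun setT (fun q : H => q.2.1) by exact: measurableT_comp.
have m4 : measurable_fun setT (fun q : H => q.2.2) by exact: measurableT_comp.
move: v => [[x y] z].
have := measurable_qconj x y z m1 m3 m4 m2 mN.
by congr (measurable_fun _ _); apply/funext => -[[a d] [b c]].
Qed.

Let e3 : R * R * R := (0, 0, 1).

(** The Hopf map: with [z1 = a + d k], [z2 = b + c k] and [k] as imaginary unit, the horizontal part
    is [-2 k z1 z2] and the height [|z1|^2 - |z2|^2], both divided by the squared norm. *)
Lemma dir_e3 (a b c d : R) : dir e3 ((a, d), (b, c)) =
  row3 (2 * (b * d + a * c) / nsq4 ((a, d), (b, c)))
       (2 * (c * d - a * b) / nsq4 ((a, d), (b, c)))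
       ((nsq (a, d) - nsq (b, c)) / nsq4 ((a, d), (b, c))).
Proof. by rewrite /dir /qconj /= /nsq /=; congr row3; congr (_ / _); ring. Qed.

Lemma dir_sphere2 q : 0 < nsq4 q -> sphere2 (dir e3 q).
Proof.
move=> q0; rewrite /sphere2 /mkset inner_dir mulrAC divff ?mul1r.
  by rewrite /dot /= mul0r !add0r mulr1.
by rewrite expf_neq0// gt_eqF.
Qed.

(** Turning [z1] alone multiplies [z1 z2] by a unit and keeps the height, so it acts on the Hopf map
    as [rotz t]. *)
Lemma preserves_turn (t : R) :
  preserves leb4 (fun q => ((cos t * q.1.1 - sin t * q.1.2,
    sin t * q.1.1 + cos t * q.1.2), q.2)).
Proof.
have turn p s : p ^+ 2 + s ^+ 2 = 1 ->
    preserves leb2 (fun z => (p * z.1 - s * z.2, s * z.1 + p * z.2)).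
  have [->|p1 ps] := eqVneq p (-1); last exact: preserves_rotation.
  rewrite sqrrN expr1n -[X in _ = X]addr0 => /addrI/eqP.
  rewrite sqrf_eq0 => /eqP ->.
  (* The half-turn, excluded in [preserves_rotation], is the square of the quarter-turn. *)
  have rot90 : preserves leb2 (fun z => (0 * z.1 - 1 * z.2, 1 * z.1 + 0 * z.2)).
    by apply: preserves_rotation; [rewrite eq_sym oppr_eq0 oner_neq0|ring].
  have := preserves_comp rot90 rot90.
  by congr (preserves _ _); apply/funext => z /=; congr pair; ring.
have tt := turn _ _ (cos2Dsin2 t).
apply: (@preserves_shear_fst _ _ _ _ _ leb2 leb2
  (fun _ z => (cos t * z.1 - sin t * z.2, sin t * z.1 + cos t * z.2))) => //.
by have [mt _] := tt; exact: (measurableT_comp mt).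
Qed.

Lemma nsq_turn t (a d : R) :
  nsq (cos t * a - sin t * d, sin t * a + cos t * d) = nsq (a, d).
Proof.
rewrite /nsq /=; transitivity ((cos t ^+ 2 + sin t ^+ 2) * (a ^+ 2 + d ^+ 2)).
  by ring.
by rewrite cos2Dsin2 mul1r.
Qed.

Lemma rotz_dir t q : rotz t (dir e3 q) =
  dir e3 ((cos t * q.1.1 - sin t * q.1.2, sin t * q.1.1 + cos t * q.1.2), q.2).
Proof.
case: q => [[a d] [b c]] /=; rewrite !dir_e3 /rotz row3K /=.
rewrite /nsq4 /= nsq_turn; congr row3.
- by rewrite !mulrA -mulrBl; congr (_ / _); ring.
- by rewrite !mulrA -mulrDl; congr (_ / _); ring.
Qed.

Let sphere_measure_fin : fin_num_fun (@sphere_measure R).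
Proof.
move=> A mA; have mS := @measurable_sphere2 R.
rewrite ge0_fin_numE//; apply: (@le_lt_trans _ _ (sphere_measure (@sphere2 R `|` ~` @sphere2 R))).
  apply: le_measure; rewrite ?inE//; last by rewrite setUv.
  by apply: measurableU => //; exact: measurableC.
apply: le_lt_trans (measureU2 _ _ _) _ => //; first exact: measurableC.
by rewrite [X in (X + _)%E]sphere_measure_sphere2 [X in (_ + X)%E]sphere_measureC ltry.
Qed.

Lemma dir_e3_law A : measurable A ->
  leb4 (ball4 `&` dir e3 @^-1` A) = (leb4 ball4 * sphere_measure A)%E.
Proof.
pose m1 := @finite_law _ _ _ _ _ leb4 ball4 (dir e3) measurable_ball4
  leb4_ball4_fin (measurable_dir e3).
have m1E A' : m1 A' = leb4 (dir e3 @^-1` A' `&` ball4) by [].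
pose m2 : {finite_measure set (borel_rV3 R) -> \bar R} :=
  HB.pack (@sphere_measure R) (Measure_isFinite.Build _ _ _ (@sphere_measure R) sphere_measure_fin).
have c0 : 0 <= fine (leb4 ball4) by rewrite fine_ge0.
have cE : (fine (leb4 ball4))%:E = leb4 ball4 by rewrite fineK// leb4_ball4_fin.
have inv1 t B : 0 <= t <= 2 * pi -> measurable B -> m1 (rotz t @^-1` B) = m1 B.
  move=> _ mB; have [mt pt] := preserves_turn t.
  rewrite !m1E -[RHS]pt; last first.
    apply: measurableI; last exact: measurable_ball4.
    exact: measurable_preimage (measurable_dir e3) mB.
  congr (leb4 _); rewrite preimage_setI; congr (_ `&` _).
    by apply/seteqP; split => q; rewrite /preimage /mkset rotz_dir.
  apply/seteqP; split => -[[a d] [b c]]; rewrite /ball4 /preimage /mkset /=;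
    by rewrite nsq_turn.
have inv2 t B : 0 <= t <= 2 * pi -> measurable B -> m2 (rotz t @^-1` B) = m2 B.
  exact: sphere_measure_rotz.
have S1 : m1 (~` @sphere2 R) = 0%E.
  rewrite m1E (_ : _ `&` _ = set0) ?measure0//.
  by apply/seteqP; split => q // [nS /andP[q0 _]]; apply: nS; exact: dir_sphere2.
have S2 : m2 (~` @sphere2 R) = 0%E by exact: sphere_measureC.
have S3 : m1 (@sphere2 R) = ((fine (leb4 ball4))%:E * m2 (@sphere2 R))%E.
  rewrite m1E cE (_ : _ `&` _ = ball4); last first.
    by apply/setIidPr => q /andP[q0 _]; exact: dir_sphere2.
  by rewrite [X in (_ * X)%E]sphere_measure_sphere2 mule1.
have caps (z : R) : -1 <= z < 1 -> m1 [set x | (z < (coords x).2)%R] =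
    ((fine (leb4 ball4))%:E * m2 [set x | (z < (coords x).2)%R])%E.
  move=> z12; have /andP[z1 z2] := z12; rewrite cE.
  have -> : m2 [set x | (z < (coords x).2)%R] = ((1 - z) / 2)%:E.
    exact: sphere_measure_cap.
  (* For [k = (1 - z) / 2], [n1 = nsq q.1], [n2 = nsq q.2], the condition
     [z < (n1 - n2) / (n1 + n2)] reads [n2 * (1 - k) < n1 * k], as in [leb4_cap]. *)
  have k01 : 0 < (1 - z) / 2 <= 1 by apply/andP; split; lra.
  rewrite muleC -(leb4_cap k01) m1E setIC; congr (leb4 _); apply/seteqP.
  have E q : ball4 q -> (z < (coords (dir e3 q)).2) =
      (nsq q.2 * (1 - (1 - z) / 2) < nsq q.1 * ((1 - z) / 2)).
    case: q => [[a d] [b c]] /andP[q0 _]; rewrite dir_e3 row3K /=.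
    rewrite ltr_pdivlMr// /nsq4 /=; apply/idP/idP; lra.
  by split => q [bq p]; split => //; move: p; rewrite /preimage /mkset E.
move=> mA; have := rotz_invariant_unique (c := NngNum c0) inv1 inv2 S1 S2 S3 caps mA.
by rewrite m1E setIC => ->; rewrite /= cE.
Qed.

Lemma dir_rotation (p v w : R) q : p ^+ 2 + v ^+ 2 + w ^+ 2 = 1 ->
  dir (2 * p * w, - (2 * p * v), p ^+ 2 - v ^+ 2 - w ^+ 2) q =
  dir e3 ((p * q.1.1 - v * q.2.1 - w * q.2.2, p * q.1.2 + w * q.2.1 - v * q.2.2),
          (p * q.2.1 + v * q.1.1 - w * q.1.2, p * q.2.2 + v * q.1.2 + w * q.1.1)).
Proof.
case: q => [[a d] [b c]] pvw; rewrite /dir /=.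
have -> : nsq4 (p * a - v * b - w * c, p * d + w * b - v * c,
    (p * b + v * a - w * d, p * c + v * d + w * a)) = nsq4 (a, d, (b, c)).
  rewrite -[RHS]mul1r -pvw /nsq4 /nsq /=; ring.
by congr row3; congr (_ / _); ring.
Qed.

Lemma nsq4_rotation (p v w : R) q : p ^+ 2 + v ^+ 2 + w ^+ 2 = 1 ->
  nsq4 ((p * q.1.1 - v * q.2.1 - w * q.2.2, p * q.1.2 + w * q.2.1 - v * q.2.2),
        (p * q.2.1 + v * q.1.1 - w * q.1.2, p * q.2.2 + v * q.1.2 + w * q.1.1)) =
  nsq4 q.
Proof.
by move=> pvw; rewrite -[RHS]mul1r -pvw /nsq4 /nsq /=; ring.
Qed.

(** A unit vector other than the south pole is the image of [e3] under a unit quaternion without [k]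
    component, so [dir_rotation] and the invariance of [leb4] reduce to [dir_e3_law]. *)
Lemma dir_law u A : dot u u = 1 -> u.2 != -1 -> measurable A ->
  leb4 (ball4 `&` dir u @^-1` A) = (leb4 ball4 * sphere_measure A)%E.
Proof.
move: u => [[x y] z]; rewrite /dot /= -!expr2 => xyz z1 mA.
have z1' : 0 < 1 + z.
  rewrite lt0r addrC addr_eq0 z1 /= addrC; nra.
(* The cosine of half the angle between the vector and [e3]; it would vanish at the south pole. *)
pose p := Num.sqrt ((1 + z) / 2).
have p0 : 0 < p by rewrite sqrtr_gt0 divr_gt0.
have p2 : p ^+ 2 = (1 + z) / 2 by rewrite sqr_sqrtr// divr_ge0// ltW.
pose v := - y / (2 * p); pose w := x / (2 * p).
have pn0 : p != 0 by rewrite gt_eqF.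
have vw : v ^+ 2 + w ^+ 2 = (1 - z) / 2.
  have -> : v ^+ 2 + w ^+ 2 = (x ^+ 2 + y ^+ 2) / (4 * p ^+ 2).
    by rewrite /v /w; field.
  have -> : x ^+ 2 + y ^+ 2 = 1 - z ^+ 2 by rewrite -xyz addrK.
  by rewrite p2; field; rewrite gt_eqF.
have pvw : p ^+ 2 + v ^+ 2 + w ^+ 2 = 1 by rewrite -addrA vw p2; field.
have uE : (x, y, z) = (2 * p * w, - (2 * p * v), p ^+ 2 - v ^+ 2 - w ^+ 2).
  congr (_, _, _); [by rewrite /w; field|by rewrite /v; field|].
  by rewrite -addrA -opprD vw p2; field.
have p1 : p != -1 by rewrite gt_eqF// (lt_trans _ p0)// ltrN10.
have [mt pt] := preserves_rotation4 p1 pvw.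
rewrite uE -(dir_e3_law mA) -[RHS]pt; last first.
  apply: measurableI; first exact: measurable_ball4.
  exact: measurable_preimage (measurable_dir e3) mA.
congr (leb4 _); rewrite preimage_setI; congr (_ `&` _).
  apply/seteqP; split => q; rewrite /ball4 /preimage /mkset;
  by have := nsq4_rotation q pvw; rewrite /nsq4 => ->.
by apply/seteqP; split => q; rewrite /preimage /mkset dir_rotation.
Qed.

End random_rotation.

(** * The weighted orthogonality graph *)

Section independent_weight.
Variables (T : Type) (e : rel T) (w : T -> nat).

Definition total_weight (s : seq T) : nat := sumn (map w s).

(* Branch and bound; [n] is fuel, as the recursion on the list of remaining
   non-neighbours is not structural. *)
Fixpoint indep_weight_le (n : nat) (s : seq T) (b : nat) : bool :=
  if (total_weight s <= b)%N then true else
  if n is n'.+1 then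
    if s is x :: s' then
      [&& (w x <= b)%N,
          indep_weight_le n' [seq y <- s' | ~~ e x y] (b - w x) &
          indep_weight_le n' s' b]
    else true
  else false.

(** If [P] holds at the head, its neighbours fail [P] and filtering them out loses nothing;
    otherwise the head itself is lost by the filter. *)
Lemma indep_weight_leP (P : pred T) n s b :
  (forall x y, P x -> P y -> ~~ e x y) ->
  indep_weight_le n s b -> (total_weight [seq x <- s | P x] <= b)%N.
Proof.
move=> indep; have small u c : (total_weight u <= c)%N ->
    (total_weight [seq x <- u | P x] <= c)%N.
  apply: leq_trans; elim: u => //= x u; rewrite /total_weight /=.
  by case: ifP => _ /= h; [rewrite leq_add2l|exact: leq_trans h (leq_addl _ _)].
elim: n s b => [|n IHn] s b /=; first by case: ifP => // /small.
case: ifP => [/small//|_]; case: s => [//|x s] /and3P[xb h1 h2] /=.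
case: ifP => Px; last exact: IHn h2.
(* The test [w x <= b] of the search makes the truncated subtraction [b - w x] exact. *)
rewrite /total_weight /= -leq_subRL//.
have := IHn _ _ h1; rewrite -filter_predI /total_weight.
congr (is_true (leq (sumn (map w _)) _)).
by apply: eq_filter => y /=; case: (boolP (P y)) => //= Py; exact: indep.
Qed.

End independent_weight.

(** * The 37 integer rays and their weights *)

Definition ray := (int * int * int)%type.

Definition idot (u v : ray) : int := u.1.1 * v.1.1 + u.1.2 * v.1.2 + u.2 * v.2.

Definition coefs : seq int := [:: - 2%:Z; - 1%:Z; 0; 1; 2%:Z].

(* Picks one vector on each line, never the south pole (0, 0, -1), whose
   direction [dir_law] does not cover. *)
Definition upper (v : ray) : bool :=
  (0 < v.2) || (v.2 == 0) && ((0 < v.1.2) || (v.1.2 == 0) && (0 < v.1.1)).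

(* The optimal weights, constant on each orbit of the cube group, of the linear
   program for the fractional chromatic number; indexed by the squared norm. *)
Definition weight (v : ray) : nat := nth 0%N [:: 0; 8; 6; 5; 0; 1; 1]%N `|idot v v|.

(** Listed by increasing norm, hence by nonincreasing weight, so that the search branches on heavy
    rays first. *)
Definition rays : seq ray :=
  let box := [seq (p, c) | p <- [seq (a, b) | a <- coefs, b <- coefs], c <- coefs] in
  flatten [seq [seq v <- box | upper v && (idot v v == k%:Z)] | k <- [:: 1; 2; 3; 5; 6]%N].

Definition orthogonal_rays (u v : ray) : bool := idot u v == 0.

Lemma total_weight_rays : total_weight weight rays = 104%N.
Proof. by vm_compute. Qed.

(** Each recursive call drops at least one ray, so the number of rays is enough fuel. *)
Lemma rays_indep : indep_weight_le orthogonal_rays weight (size rays) rays 32.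
Proof. by vm_compute. Qed.

Lemma rays_upper : all (fun v => upper v && (0 < idot v v)) rays.
Proof. by vm_compute. Qed.

(** The complement of a Borel cover of the complement of [I] is a Borel subset of [I], so the cover
    has measure at least [1 - b]. The Caratheodory criterion then splits the total mass 1 between
    [I] and its complement. *)
Lemma inner_measure_bound (R : realType) (I : set 'rV[R]_3) (b : R) :
  lebesgue_measurable_sphere I ->
  (forall B : set (borel_rV3 R), measurable B -> B `<=` I ->
    (sphere_measure B <= b%:E)%E) ->
  (lambda I <= b%:E)%E.
Proof.
move=> [_ mI] Ib; have mS := @measurable_sphere2 R.
have fullT : sphere_measure [set: borel_rV3 R] = 1%E.
  rewrite -(setUv (@sphere2 R)) measureU//; [|exact: measurableC|exact: setICr].
  by rewrite [X in (X + _)%E]sphere_measure_sphere2 [X in (_ + X)%E]sphere_measureC adde0.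
rewrite /lambda /completed_measure_extension.
have extT : (@sphere_measure R)^*%mu setT = 1%E.
  by apply: eq_trans (measurable_mu_extE _ _) fullT.
have E : (1 = (@sphere_measure R)^*%mu I + (@sphere_measure R)^*%mu (~` I))%E.
  by have := mI setT; rewrite !setTI => h; exact: eq_trans (esym extT) h.
have : (1 - b%:E <= (@sphere_measure R)^*%mu (~` I))%E.
  apply: le_ereal_inf_tmp => _ [F [mF IF] <-].
  have mU : measurable (\bigcup_k F k) by exact: bigcupT_measurable.
  apply: (@le_trans _ _ (sphere_measure (\bigcup_k F k))); last first.
    exact: measure_sigma_subadditive.
  have UI : ~` (\bigcup_k F k) `<=` I.
    by move=> x nx; apply: contrapT => /IF.
  rewrite leeBlDr// -fullT -(setUv (\bigcup_k F k)) measureU//;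
    [|exact: measurableC|exact: setICr].
  by apply: leeD2l; apply: Ib => //; exact: measurableC.
have : (0 <= (@sphere_measure R)^*%mu I)%E by exact: mu_ext_ge0.
have : (0 <= (@sphere_measure R)^*%mu (~` I))%E by exact: mu_ext_ge0.
move: E; move: ((@sphere_measure R)^*%mu I) ((@sphere_measure R)^*%mu (~` I)).
move=> [x| |] [y| |] //= [].
by rewrite -EFinB !lee_fin => h1 _ _ h2; lra.
Qed.

(** Double counting: the pointwise bound on the weighted sum of indicators is integrated over
    [D]. *)
Lemma weighted_sum_measure (R : realType) d (T : measurableType d)
    (mu : {measure set T -> \bar R}) (D : set T) (I : Type) (s : seq I)
    (w : I -> nat) (E : I -> set T) (b : nat) :
  measurable D -> (forall i, measurable (E i)) ->
  (forall x, D x -> (total_weight w [seq i <- s | x \in E i] <= b)%N) ->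
  (\sum_(i <- s) (w i)%:R%:E * mu (D `&` E i) <= b%:R%:E * mu D)%E.
Proof.
move=> mD mE wb.
have mf i : measurable_fun D (fun x => ((w i)%:R * \1_(E i) x)%:E : \bar R).
  by apply/measurable_EFinP; apply: measurable_funM.
rewrite (_ : (\sum_(i <- s) _)%E =
    (\int[mu]_(x in D) \sum_(i <- s) ((w i)%:R * \1_(E i) x)%:E)%E); last first.
  rewrite ge0_integral_sum//.
  apply: eq_bigr => i _; under eq_integral do rewrite EFinM.
  rewrite ge0_integralZl//; last first.
    by apply/measurable_EFinP; exact: measurable_indic.
  by rewrite integral_indic// setIC.
rewrite -integral_cst//; apply: ge0_le_integral => //.
- by move=> x _; apply: sume_ge0 => i _; rewrite lee_fin mulr_ge0.
- exact: emeasurable_sum.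
move=> x Dx; rewrite sumEFin lee_fin.
apply: (@le_trans _ _ (total_weight w [seq i <- s | x \in E i])%:R); last first.
  by rewrite ler_nat wb.
elim: s {wb} => [|i s IHs]; first by rewrite big_nil.
rewrite big_cons /total_weight /= indicE; case: ifP => _ /=.
  by rewrite mulr1 natrD lerD2l.
by rewrite mulr0 add0r.
Qed.

(** * The averaging argument for Borel sets *)

Section borel_bound.
Context {R : realType}.

Definition real_ray (v : ray) : R * R * R :=
  let n := Num.sqrt (idot v v)%:~R in
  (v.1.1%:~R / n, v.1.2%:~R / n, v.2%:~R / n).

Lemma dot_real_ray u v : dot (real_ray u) (real_ray v) =
  (idot u v)%:~R / (Num.sqrt (idot u u)%:~R * Num.sqrt (idot v v)%:~R).
Proof.
rewrite /dot /real_ray /= ![_ / _ * _]mulrACA -!mulrDl -invfM.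
by congr (_ / _); rewrite /idot !rmorphD !rmorphM.
Qed.

Lemma borel_zero_avoiding (A : set (borel_rV3 R)) : measurable A ->
  zero_avoiding A -> (sphere_measure A <= (4 / 13)%:E)%E.
Proof.
move=> mA avoid; have mB := @measurable_ball4 R.
have mE v : measurable (dir (real_ray v) @^-1` A).
  exact: measurable_preimage (measurable_dir _) mA.
(* For every [q], orthogonal rays have orthogonal directions, so those with direction in [A] form an
   independent set. *)
have bound q : (total_weight weight
    [seq v <- rays | q \in dir (real_ray v) @^-1` A] <= 32)%N.
  apply: indep_weight_leP rays_indep => u v /set_mem uA /set_mem vA.
  apply/negP => /eqP uv0; apply: (avoid _ _ uA vA).
  by rewrite inner_dir dot_real_ray uv0 !mul0r mulr0 mul0r.
have : (\sum_(v <- rays) (weight v)%:R%:E *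
    leb4 (ball4 `&` dir (real_ray v) @^-1` A) <= 32%:R%:E * leb4 ball4 :> \bar R)%E.
  by apply: weighted_sum_measure => // q _; exact: bound.
(* All directions have the same law, so the weights factor out and add up to 104. *)
have -> : (\sum_(v <- rays) (weight v)%:R%:E *
    leb4 (ball4 `&` dir (real_ray v) @^-1` A) =
    104%:R%:E * (leb4 ball4 * sphere_measure A))%E.
  rewrite -total_weight_rays /total_weight sumnE big_map natr_sum -sumEFin.
  rewrite ge0_sume_distrl => [|v _]; last by rewrite lee_fin.
  rewrite big_seq [RHS]big_seq; apply: eq_bigr => v vr; congr (_ * _)%E.
  have /allP/(_ _ vr)/andP[up v0] := rays_upper.
  have n0 : 0 < Num.sqrt (idot v v)%:~R :> R by rewrite sqrtr_gt0 ltr0z.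
  apply: dir_law => //.
    rewrite dot_real_ray -expr2 sqr_sqrtr ?divff//; last by rewrite ler0z ltW.
    by rewrite intr_eq0 gt_eqF.
  rewrite /real_ray /= gt_eqF// (@lt_le_trans _ _ 0)// ?ltrN10//.
  rewrite divr_ge0 ?(ltW n0)// ler0z; case/orP: up => [/ltW//|/andP[/eqP ->]//].
have K0 := @leb4_ball4_gt0 R; have Kfin := @leb4_ball4_fin R.
have {}K0 : 0 < fine (leb4 ball4) :> R by rewrite fine_gt0// K0 ltey_eq Kfin.
rewrite -(fineK Kfin).
have : (0 <= sphere_measure A)%E by exact: measure_ge0.
move: (sphere_measure A) => [a| |] // _.
  rewrite -!EFinM !lee_fin => h.
  have : 104%:R * a <= 32%:R by rewrite -(ler_pM2r K0) -mulrA [a * _]mulrC.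
  by move=> ?; lra.
(* An infinite [sphere_measure A] would put [+oo] below a finite number. *)
rewrite mulry gtr0_sg// mul1e mulry gtr0_sg// mul1e -EFinM.
by rewrite leye_eq.
Qed.

End borel_bound.

Theorem theorem7 (R : realType) : (alpha3 R < (313 / 1000)%:E)%E.
Proof.
apply: (@le_lt_trans _ _ (4 / 13)%:E); last by rewrite lte_fin; lra.
apply: ge_ereal_sup => _ [I [mI avoid] <-].
apply: (inner_measure_bound mI) => B mB BI.
by apply: borel_zero_avoiding => // x y /BI Ix /BI Iy; exact: avoid.
Qed.
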